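(* Let $n\ge 2$ and $\theta\in(\frac{\pi}{2},\pi)$. Then the capillary volume product has no finite upper bound: for every $M>0$ there exists an even, smooth, strictly convex $\theta$-capillary hypersurface $\Sigma\subset\overline{\mathbb{R}^n_+}$ such that $$\operatorname{vol}(\widehat\Sigma)\,\operatorname{vol}(\widehat{\Sigma^*})>M .$$
   Context: Let $\{E_i\}_{i=1}^n$ be the standard basis of $\mathbb{R}^n$ with standard inner product $\langle\cdot,\cdot\rangle$ and let $\mathbb{R}^n_+ = \{x : \langle x,E_n\rangle>0\}$. Capillary hypersurface: let $\Sigma\subset\overline{\mathbb{R}^n_+}$ be a properly embedded, smooth, compact, connected, orientable hypersurface whose relative interior lies in $\mathbb{R}^n_+$ and whose boundary satisfies $\partial\Sigma\subset\partial\mathbb{R}^n_+$. It is $\theta$-capillary if $\langle \nu,E_n\rangle\equiv\cos\theta$ along $\partial\Sigma$, where $\nu$ is the outer unit normal of $\Sigma$. $\widehat\Sigma$ is the region enclosed by $\Sigma$ and $\partial\mathbb{R}^n_+$. $\Sigma$ is strictly convex if $\widehat\Sigma$ is a convex body (compact convex with non-empty interior) and the second fundamental form of $\Sigma$ is positive definite. Model cap: $\mathcal{C}_{\theta} = \{ x \in \overline{\mathbb{R}^n_+} : |x + \cos \theta\, E_n| = 1 \}$. Capillary support function: for $\Sigma$ strictly convex, the map $\tilde\nu=\nu-\cos\theta\,E_n:\Sigma\to\mathcal{C}_\theta$ is a diffeomorphism, and $s_\Sigma(\zeta)=\langle\tilde\nu^{-1}(\zeta),\zeta+\cos\theta\,E_n\rangle$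 for $\zeta\in\mathcal{C}_\theta$. $\Sigma$ is even if $s_\Sigma(-\zeta_1,\dots,-\zeta_{n-1},\zeta_n)=s_\Sigma(\zeta_1,\dots,\zeta_{n-1},\zeta_n)$ for all $\zeta\in\mathcal{C}_\theta$; in this case $s_\Sigma>0$. The capillary support function of $\mathcal{C}_\theta$ is $\ell(\zeta)=\sin^2\theta-\cos\theta\,\langle\zeta,E_n\rangle$. Capillary polar body: $\widehat{\Sigma^*}=\{r\zeta:\ \zeta\in\mathcal{C}_\theta,\ 0\le r\le \ell(\zeta)/s_\Sigma(\zeta)\}\subset\overline{\mathbb{R}^n_+}$. The capillary volume product of $\Sigma$ is $\operatorname{vol}(\widehat\Sigma)\operatorname{vol}(\widehat{\Sigma^*})$. *)

(* Defs.v *)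
From HB Require Import structures.
From mathcomp Require Import all_boot all_order all_algebra.
From mathcomp Require Import all_classical all_reals all_analysis.

Set Implicit Arguments.
Unset Strict Implicit.
Unset Printing Implicit Defensive.

Import Order.TTheory GRing.Theory Num.Theory.
Import numFieldNormedType.Exports.

Local Open Scope classical_set_scope.
Local Open Scope ring_scope.

(* The library norm on ['rV[R]_n] is the sup norm: it is used below only for
   the topology, boundedness and differentiability, none of which depends on
   the choice of norm. Lengths and angles go through [dot] and [enorm]. *)
Section Euclidean.
Context {R : realType} {n : nat}.
Implicit Types x y : 'rV[R]_n.

Definition dot x y : R := \sum_i x 0 i * y 0 i.

Definition enorm x : R := Num.sqrt (dot x x).

Definition En : 'rV[R]_n := \row_i (i.+1 == n)%:R.

Definition height x : R := dot x En.

Definition upper_half_space : set 'rV[R]_n := [set x | 0 < height x].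

Definition horizontal_reflection x : 'rV[R]_n :=
  \row_i (if i.+1 == n then x 0 i else - x 0 i).

Definition box (a b : 'rV[R]_n) : set 'rV[R]_n :=
  [set x | forall i, a 0 i <= x 0 i <= b 0 i].

(* Lebesgue outer measure, which is Lebesgue measure on measurable sets
   (for n > 0, where degenerate boxes have volume 0). *)
Definition vol (A : set 'rV[R]_n) : \bar R :=
  ereal_inf [set v | exists a b : nat -> 'rV[R]_n,
    [/\ forall k i, a k 0 i <= b k 0 i,
        A `<=` \bigcup_k box (a k) (b k) &
        v = (\sum_(k <oo) (\prod_i (b k 0 i - a k 0 i))%:E)%E]].

End Euclidean.

Section Smooth.
Context {R : realType}.

Fixpoint Ck {V W : normedModType R} (k : nat) (U : set V) (f : V -> W) : Prop :=
  match k with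
  | 0 => forall x, U x -> {for x, continuous f}
  | k'.+1 => (forall x, U x -> differentiable f x) /\
             (forall v, Ck k' U (fun x => 'D_v f x))
  end.

(* Meaningful for open [U]. *)
Definition smooth {V W : normedModType R} (U : set V) (f : V -> W) : Prop :=
  forall k, Ck k U f.

Definition diffeomorphism {n : nat} (U V : set 'rV[R]_n)
    (phi psi : 'rV[R]_n -> 'rV[R]_n) : Prop :=
  [/\ open U, open V, smooth U phi, smooth V psi &
      (forall x, U x -> V (phi x) /\ psi (phi x) = x) /\
      (forall y, V y -> U (psi y) /\ phi (psi y) = y)].

End Smooth.

Section Hypersurface.
Context {R : realType} {n : nat}.
Implicit Types (S B : set 'rV[R]_n) (p v w : 'rV[R]_n).

Definition interior_chart S p : Prop :=
  exists U V phi psi (i : 'I_n),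
    [/\ diffeomorphism U V phi psi, U p &
        forall x, U x -> (S x <-> phi x 0 i = 0)].

Definition boundary_chart S p : Prop :=
  exists U V phi psi (i j : 'I_n),
    [/\ diffeomorphism U V phi psi, U p, i != j, phi p 0 j = 0 &
        forall x, U x -> (S x <-> phi x 0 i = 0 /\ 0 <= phi x 0 j)].

(* [S] is an embedded smooth hypersurface of R^n with manifold boundary [B]. *)
Definition smooth_hypersurface S B : Prop :=
  [/\ B `<=` S,
      forall p, (S `\` B) p -> interior_chart S p &
      forall p, B p -> boundary_chart S p].

Definition curve_velocity S p v : Prop :=
  exists gamma : R -> 'rV[R]_n,
    [/\ is_derive (0 : R) 1 gamma v, gamma 0 = p &
        \forall t \near 0^'+, S (gamma t)].

(* At a boundary point only the half space of inward vectors is reached by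
   curves leaving [p] inside [S]; the opposite vectors complete T_p S. *)
Definition tangent S p v : Prop :=
  curve_velocity S p v \/ curve_velocity S p (- v).

Definition unit_normal_field S (nu : 'rV[R]_n -> 'rV[R]_n) : Prop :=
  forall p, S p -> enorm (nu p) = 1 /\ forall v, tangent S p v -> dot (nu p) v = 0.

Definition smooth_extension S (f : 'rV[R]_n -> 'rV[R]_n) p
    (F : 'rV[R]_n -> 'rV[R]_n) : Prop :=
  exists U, [/\ open U, U p, smooth U F & forall x, U x -> S x -> F x = f x].

Definition smooth_on S (f : 'rV[R]_n -> 'rV[R]_n) : Prop :=
  forall p, S p -> exists F, smooth_extension S f p F.

(* II_p(v, w) = <d nu_p v, w>, for [N] extending the unit normal [nu] near [p];
   for tangent [v] it does not depend on [N]. With [nu] outward, round spheres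
   have positive definite II. *)
Definition second_fundamental_form (N : 'rV[R]_n -> 'rV[R]_n) p v w : R :=
  dot ('D_v N p) w.

Definition positive_definite_sff S (nu : 'rV[R]_n -> 'rV[R]_n) : Prop :=
  forall p N, S p -> smooth_extension S nu p N ->
    forall v, tangent S p v -> v != 0 -> 0 < second_fundamental_form N p v v.

(* The region enclosed by [S] and the hyperplane bounding the half space: the
   closure of the bounded components of the complement of [S] in the open half
   space. *)
Definition enclosed_region S : set 'rV[R]_n :=
  closure [set x | (upper_half_space `\` S) x /\
    bounded_set (connected_component (upper_half_space `\` S) x)].

Definition convex_body (K : set 'rV[R]_n) : Prop :=
  [/\ compact K, convex_set K & K^° !=set0].

End Hypersurface.

Section Capillary.
Context {R : realType}.

(* A compact subset of R^n is properly embedded. Orientability is witnessed by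
   [cap_normal]. At boundary points the outward direction is fixed by continuity
   from the relative interior. *)
Record capillary_hypersurface (n : nat) (theta : R) := CapillaryHypersurface {
  cap_set :> set 'rV[R]_n ;
  cap_boundary : set 'rV[R]_n ;
  cap_normal : 'rV[R]_n -> 'rV[R]_n ;
  cap_smooth : smooth_hypersurface cap_set cap_boundary ;
  cap_compact : compact cap_set ;
  cap_connected : connected cap_set ;
  cap_interior_pos : cap_set `\` cap_boundary `<=` upper_half_space ;
  cap_boundary_flat : forall p, cap_boundary p -> height p = 0 ;
  cap_boundary_neq0 : cap_boundary !=set0 ;
  cap_normal_smooth : smooth_on cap_set cap_normal ;
  cap_normal_unit : unit_normal_field cap_set cap_normal ;
  cap_normal_outer : forall p, (cap_set `\` cap_boundary) p ->
    \forall t \near 0^'+, ~ enclosed_region cap_set (p + t *: cap_normal p) ;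
  cap_angle : forall p, cap_boundary p -> dot (cap_normal p) En = cos theta
}.

Context {n : nat} {theta : R}.
Implicit Types (S : capillary_hypersurface n theta) (zeta : 'rV[R]_n).

Definition strictly_convex S : Prop :=
  convex_body (enclosed_region S) /\ positive_definite_sff S (cap_normal S).

Definition model_cap : set 'rV[R]_n :=
  [set x | 0 <= height x /\ enorm (x + cos theta *: En) = 1].

Definition capillary_gauss_map S (x : 'rV[R]_n) : 'rV[R]_n :=
  cap_normal S x - cos theta *: En.

(* [get] picks the unique preimage of [zeta] under the capillary Gauss map,
   which is a bijection from [S] to [model_cap] when [S] is strictly convex. *)
Definition capillary_support S zeta : R :=
  dot (get [set x | cap_set S x /\ capillary_gauss_map S x = zeta])
      (zeta + cos theta *: En).

Definition capillary_even S : Prop :=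
  forall zeta, model_cap zeta ->
    capillary_support S (horizontal_reflection zeta) = capillary_support S zeta.

Definition model_support zeta : R := sin theta ^+ 2 - cos theta * dot zeta En.

Definition polar_body S : set 'rV[R]_n :=
  [set x | exists r zeta, [/\ model_cap zeta, 0 <= r,
     r <= model_support zeta / capillary_support S zeta & x = r *: zeta]].

Definition capillary_volume_product S : \bar R :=
  (vol (enclosed_region S) * vol (polar_body S))%E.

End Capillary.

(* Main.v *)
From HB Require Import structures.
Require Import Defs.
From mathcomp Require Import all_boot all_order all_algebra.
From mathcomp Require Import all_classical all_reals all_analysis.
From mathcomp Require Import measurable_realfun ring lra.

Set Implicit Arguments.
Unset Strict Implicit.
Unset Printing Implicit Defensive.

Import Order.TTheory GRing.Theory Num.Theory.
Import numFieldNormedType.Exports.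

Local Open Scope classical_set_scope.
Local Open Scope ring_scope.

(** Long thin ellipsoids, cut by the boundary hyperplane, already have
unbounded volume product. Put c = - cos theta and s = sin theta, both positive,
and write x = (x', x_n). For e > 0 consider the part in the closed half space of
the ellipsoid |x'|^2 + e (x_n - z0)^2 = 1, which meets the hyperplane in a
sphere of radius rho with rho^2 + e z0^2 = 1. Its normal makes a constant angle
with E_n along that sphere, and the capillary condition is e z0 s = c rho. For
every vertical semi-axis b = e^(-1/2) these equations have the positive
solution z0 = b^2 c / D, rho = s / D with D^2 = s^2 + b^2 c^2. It is enough to let b
tend to infinity.

- The centre of the ellipsoid lies above the hyperplane, so the enclosed region
  contains a box with fixed horizontal sides and height b / 2 (vol_solid_ge).
- Let zeta in the model cap have height at most c, so that the corresponding
  normal nu = zeta + cos theta E_n does not point upwards. The point of the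
  ellipsoid with normal nu then contributes through its horizontal part alone,
  up to a nonpositive term, and the support function is at most 1 whatever b is
  (capillary_support_bounds). As theta > pi / 2, these zeta fill a solid cone,
  in which the polar body therefore contains a box that does not depend on b
  (vol_polar_ge).

The volume product is thus at least a constant times b.

That the surface fits the definitions is shown as follows. Inversion, with
respect to the quadratic form of the ellipsoid, at a point N of the boundary
sphere turns the ellipsoid and the boundary hyperplane, which both pass through
N, into two hyperplanes. This gives rational charts, and two antipodal choices of
N cover the surface (smooth_hypersurface_cap); the same charts exhibit the
surface as a union of two images of convex sets, so it is connected
(connected_cap). The enclosed region is found from the components of the
complement: a connected set cannot cross the level 1 of the quadric, and a point
outside lies on a half-line that stays outside (enclosed_region_cap). The unit
normal is the normalized gradient. A function constant on the surface has zero
derivative along tangent vectors (derive_tangent), so any extension of the normal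
has the same second fundamental form as the normalized gradient, namely a
positive multiple of the quadratic form of the ellipsoid
(positive_definite_cap). *)

(** * Inner products and the quadratic form of the ellipsoid *)

Section InnerProduct.
Context {R : realType} {n : nat}.
Implicit Types (x y z : 'rV[R]_n) (k : R) (d : 'I_n -> R).

Definition rescale d x : 'rV[R]_n := \row_i (d i * x 0 i).

Lemma rescaleD d x y : rescale d (x + y) = rescale d x + rescale d y.
Proof. by apply/rowP => i; rewrite !mxE mulrDr. Qed.

Lemma rescaleZ d k x : rescale d (k *: x) = k *: rescale d x.
Proof. by apply/rowP => i; rewrite !mxE mulrCA. Qed.

Lemma dotC x y : dot x y = dot y x.
Proof. by apply: eq_bigr => i _; rewrite mulrC. Qed.

Lemma dotDl x y z : dot (x + y) z = dot x z + dot y z.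
Proof. by rewrite -big_split; apply: eq_bigr => i _; rewrite !mxE mulrDl. Qed.

Lemma dotZl k x y : dot (k *: x) y = k * dot x y.
Proof. by rewrite mulr_sumr; apply: eq_bigr => i _; rewrite !mxE mulrA. Qed.

Lemma dotDr x y z : dot z (x + y) = dot z x + dot z y.
Proof. by rewrite dotC dotDl !(dotC _ z). Qed.

Lemma dotZr k x y : dot x (k *: y) = k * dot x y.
Proof. by rewrite dotC dotZl dotC. Qed.

Lemma dotNl x y : dot (- x) y = - dot x y.
Proof. by rewrite -scaleN1r dotZl mulN1r. Qed.

Lemma dotNr x y : dot x (- y) = - dot x y.
Proof. by rewrite dotC dotNl dotC. Qed.

Lemma dot_rescale d x y : dot (rescale d x) y = dot x (rescale d y).
Proof. by apply: eq_bigr => i _; rewrite !mxE -mulrA mulrCA. Qed.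

Lemma dot_rescale_sq d x : dot (rescale d x) x = \sum_i d i * x 0 i ^+ 2.
Proof. by apply: eq_bigr => i _; rewrite !mxE expr2 mulrA. Qed.

Lemma dot_rescale_sq_gt0 d x : (forall i, 0 < d i) -> x != 0 ->
  0 < dot (rescale d x) x.
Proof.
move=> d0 /eqP x0; rewrite dot_rescale_sq lt_neqAle sumr_ge0 ?andbT; last first.
  by move=> i _; rewrite mulr_ge0 ?sqr_ge0// ltW.
rewrite eq_sym; apply/eqP => /psumr_eq0P xi0; apply: x0; apply/rowP => i.
have /eqP := xi0 (fun i _ => mulr_ge0 (ltW (d0 i)) (sqr_ge0 _)) i isT.
by rewrite mulf_eq0 sqrf_eq0 gt_eqF//= => /eqP ->; rewrite mxE.
Qed.

Lemma dot_rescale_sq_ge0 d x : (forall i, 0 < d i) -> 0 <= dot (rescale d x) x.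
Proof.
by move=> d0; rewrite dot_rescale_sq sumr_ge0// => i _;
  rewrite mulr_ge0 ?sqr_ge0 ?ltW.
Qed.

Lemma dot_rescale_sq_coord d x i : (forall i, 0 < d i) ->
  d i * x 0 i ^+ 2 <= dot (rescale d x) x.
Proof.
move=> d0; rewrite dot_rescale_sq (bigD1 i)//= lerDl sumr_ge0// => j _.
by rewrite mulr_ge0 ?sqr_ge0 ?ltW.
Qed.

Lemma dot_gt0 x : x != 0 -> 0 < dot x x.
Proof.
move=> x0; have := dot_rescale_sq_gt0 (fun=> ltr01) x0.
by have -> : rescale (fun=> 1) x = x by apply/rowP => i; rewrite mxE mul1r.
Qed.

Lemma dot_ge0 x : 0 <= dot x x.
Proof. by apply: sumr_ge0 => i _; rewrite -expr2 sqr_ge0. Qed.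

End InnerProduct.

Section EllipsoidAlgebra.
Context {R : realType} {m : nat}.
Local Notation n := m.+2.
Local Notation rV := 'rV[R]_n.
Implicit Types (x y z w : rV).

Lemma dot_En x : dot x En = x 0 ord_max.
Proof.
rewrite /dot (bigD1 ord_max)//= mxE eqxx mulr1 big1 ?addr0// => i im.
rewrite mxE (_ : (_ == _) = false) ?mulr0//.
by apply: contraNF im => /eqP [im]; apply/eqP/val_inj.
Qed.

Lemma heightE x : height x = x 0 ord_max.
Proof. exact: dot_En. Qed.

Context (e z0 : R).
Hypothesis e0 : 0 < e.

(** The ellipsoid has horizontal semi-axes 1 and vertical semi-axis e^(-1/2). *)
Definition weight (i : 'I_n) : R := if i == ord_max then e else 1.

Lemma weight_gt0 i : 0 < weight i.
Proof. by rewrite /weight; case: ifP. Qed.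

Local Notation W := (rescale weight).

Definition wdot x y := dot (W x) y.

Lemma wdotC x y : wdot x y = wdot y x.
Proof. by rewrite /wdot dot_rescale dotC. Qed.

Lemma wdotDl x y z : wdot (x + y) z = wdot x z + wdot y z.
Proof. by rewrite /wdot rescaleD dotDl. Qed.

Lemma wdotDr x y z : wdot z (x + y) = wdot z x + wdot z y.
Proof. exact: dotDr. Qed.

Lemma wdotZl k x y : wdot (k *: x) y = k * wdot x y.
Proof. by rewrite /wdot rescaleZ dotZl. Qed.

Lemma wdotZr k x y : wdot x (k *: y) = k * wdot x y.
Proof. exact: dotZr. Qed.

Lemma wdotNr x y : wdot x (- y) = - wdot x y.
Proof. exact: dotNr. Qed.

Lemma wdotNl x y : wdot (- x) y = - wdot x y.
Proof. by rewrite wdotC wdotNr wdotC. Qed.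

Lemma wdot_gt0 x : x != 0 -> 0 < wdot x x.
Proof. exact/dot_rescale_sq_gt0/weight_gt0. Qed.

Lemma wdot_ge0 x : 0 <= wdot x x.
Proof. exact/dot_rescale_sq_ge0/weight_gt0. Qed.

Lemma wdot_En x : wdot x En = e * x 0 ord_max.
Proof. by rewrite /wdot dot_En mxE /weight eqxx. Qed.

Lemma wdot_coord0 x : wdot x (delta_mx 0 0) = x 0 0.
Proof.
rewrite /wdot /dot (bigD1 0)//= !mxE/= mulr1 /weight/= mul1r big1 ?addr0// => i i0.
by rewrite [X in _ * X]mxE (negbTE i0) andbF mulr0.
Qed.

Lemma dot_wdot x y : dot x y = wdot x y + (1 - e) * (x 0 ord_max * y 0 ord_max).
Proof.
rewrite /wdot /dot !(bigD1 (P := xpredT) ord_max)//= !mxE /weight eqxx.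
rewrite [X in _ = _ + X + _](eq_bigr (fun i => x 0 i * y 0 i)); first by ring.
by move=> i im; rewrite mxE (negbTE im) mul1r.
Qed.

Definition center : rV := z0 *: En.

(** The full ellipsoid is the level set 1, and its interior is where the value is
less than 1. *)
Definition quadric x : R := wdot (x - center) (x - center).

Lemma En_max : (En : rV) 0 ord_max = 1.
Proof. by rewrite mxE eqxx. Qed.

Lemma quadricE x : quadric x = wdot x x - 2 * e * z0 * x 0 ord_max + e * z0 ^+ 2.
Proof.
rewrite /quadric /center wdotDl !wdotDr !wdotNl !wdotNr wdotZl !wdotZr (wdotC En x).
rewrite !wdot_En [(_ *: En) _ _]mxE En_max; ring.
Qed.

End EllipsoidAlgebra.

(** * Maps of class C^k *)

Section SmoothCalculus.
Context {R : realType}.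

(** Differentiability is a local property, because the expansion of f at x with
its little-o remainder only involves the germ of f. *)
Lemma near_eq_differentiable {V W : normedModType R} (f g : V -> W) (x : V) :
  {near x, f =1 g} -> differentiable f x -> differentiable g x.
Proof.
move=> fg df.
have [cdf eqf] := (diff_locallyP x f).1 df.
have fgx : f x = g x by exact: nbhs_singleton fg.
have eqg : g \o shift x = cst (g x) + 'd f x +o_ 0 id.
  apply/eqaddoP => _/posnumP[e].
  have /eqaddoP /(_ e%:num [gt0 of e%:num]) := eqf.
  have : \forall h \near (0 : V), f (h + x) = g (h + x).
    have : \forall y \near x, f y = g y by exact: fg.
    by rewrite (near_shift 0) subr0.
  apply: filterS2 => h /= fgh; rewrite /shift.
  by rewrite !fctE -fgx fgh.
have dgE : 'd g x = 'd f x :> (V -> W) by apply: diff_unique.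
by apply/diff_locallyP; rewrite dgE.
Qed.

Section domain.
Context {V : normedModType R} {U : set V}.
Hypothesis oU : open U.

(** Induction on k; the directional derivatives of f and g agree on the open set U
as well. *)
Lemma Ck_ext {W : normedModType R} k (f g : V -> W) :
  (forall x, U x -> f x = g x) -> Ck k U f -> Ck k U g.
Proof.
elim: k f g => [|k IH] f g fg /=.
  move=> cf x Ux; suff : g @ x --> f x by rewrite fg.
  apply: cvg_trans (cf x Ux); apply: near_eq_cvg.
  by apply: filterS (open_nbhs_nbhs (conj oU Ux)) => y; exact: fg.
have nfg x : U x -> {near x, f =1 g}.
  by move=> Ux; apply: filterS (open_nbhs_nbhs (conj oU Ux)) => y; exact: fg.
move=> [df dk]; split=> [x Ux|v].
  exact: near_eq_differentiable (nfg _ Ux) (df _ Ux).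
by apply: IH (dk v) => x Ux; apply: near_eq_derive; exact: nfg.
Qed.

Lemma CkW {W : normedModType R} k (f : V -> W) : Ck k.+1 U f -> Ck k U f.
Proof.
elim: k f => [|k IH] f [df dk]; first by move=> x /df /differentiable_continuous.
by split=> // v; exact/IH/dk.
Qed.

Lemma Ck_cst {W : normedModType R} k (w : W) : Ck k U (fun=> w).
Proof.
elim: k w => [|k IH] w; first by move=> x _; exact: cvg_cst.
split=> [x _|v]; first exact: differentiable_cst.
rewrite (_ : (fun x => 'D_v (fun=> w) x) = fun=> 0)//.
by apply/funext => x; rewrite derive_cst.
Qed.

Lemma CkD {W : normedModType R} k (f g : V -> W) :
  Ck k U f -> Ck k U g -> Ck k U (fun x => f x + g x).
Proof.
elim: k f g => [|k IH] f g; first by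
  move=> cf cg x Ux; apply: cvgD; [exact: cf|exact: cg].
move=> [df kf] [dg kg]; split=> [x Ux|v].
  by apply: differentiableD; [exact: df|exact: dg].
apply: Ck_ext (IH _ _ (kf v) (kg v)) => x Ux /=.
by rewrite -deriveD//; apply: diff_derivable; [exact: df|exact: dg].
Qed.

Lemma CkM k (f g : V -> R) :
  Ck k U f -> Ck k U g -> Ck k U (fun x => f x * g x).
Proof.
elim: k f g => [|k IH] f g; first by
  move=> cf cg x Ux; apply: cvgM; [exact: cf|exact: cg].
move=> /[dup]/CkW f0 [df kf] /[dup]/CkW g0 [dg kg]; split=> [x Ux|v].
  by apply: differentiableM; [exact: df|exact: dg].
apply: Ck_ext (CkD (IH _ _ f0 (kg v)) (IH _ _ g0 (kf v))) => x Ux /=.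
by rewrite [in RHS]deriveM//; apply: diff_derivable; [exact: df|exact: dg].
Qed.

Lemma Ck_sum (I : finType) (W : normedModType R) k (f : I -> V -> W) :
  (forall i, Ck k U (f i)) -> Ck k U (fun x => \sum_i f i x).
Proof.
move=> kf; elim: (index_enum I) => [|i s IH].
  by under eq_fun do rewrite big_nil; exact: Ck_cst.
by under eq_fun do rewrite big_cons; apply: CkD.
Qed.

Lemma CkV k (f : V -> R) : (forall x, U x -> f x != 0) ->
  Ck k U f -> Ck k U (fun x => (f x)^-1).
Proof.
move=> f0; elim: k => [|k IH].
  by move=> cf x Ux; apply: cvgV; [exact: f0|exact: cf].
move=> /[dup]/CkW kf [df dk]; split=> [x Ux|v].
  by apply: differentiableV; [exact: df|exact: f0].
have ku := IH kf.
have kv := CkM (CkM (@Ck_cst R k (-1)) (CkM ku ku)) (dk v).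
apply: Ck_ext kv => x Ux /=.
rewrite deriveV ?f0//; last by apply: diff_derivable; exact: df.
by rewrite mulN1r expr2 invfM.
Qed.

(** The function u = f^(-1/2) satisfies D_v u = - u^3 D_v f / 2, an expression in u
and D_v f alone, so the induction on k closes. It would not for the square
root itself. *)
Lemma Ck_sqrtV k (f : V -> R) : (forall x, U x -> 0 < f x) ->
  Ck k U f -> Ck k U (fun x => (Num.sqrt (f x))^-1).
Proof.
move=> f0; elim: k => [|k IH].
  move=> cf x Ux; apply: cvgV; first by rewrite gt_eqF// sqrtr_gt0 f0.
  exact: (cvg_comp f Num.sqrt (cf x Ux) (@sqrt_continuous _ _)).
move=> /[dup]/CkW kf [df dk].
have ds x : U x -> differentiable (Num.sqrt : R -> R) (f x).
  move=> Ux; apply/derivable1_diffP; have := is_derive1_sqrt (f0 x Ux).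
  by case.
have sn0 x : U x -> Num.sqrt (f x) != 0.
  by move=> Ux; rewrite gt_eqF// sqrtr_gt0 f0.
have dsf x : U x -> differentiable (fun y => Num.sqrt (f y)) x.
  by move=> Ux; apply: differentiable_comp; [exact: df|exact: ds].
split=> [x Ux|v]; first by apply: differentiableV; [exact: dsf|exact: sn0].
have ku := IH kf.
have kv := CkM (CkM (@Ck_cst R k (- 2^-1)) (CkM ku (CkM ku ku))) (dk v).
apply: Ck_ext kv => x Ux /=.
rewrite deriveV ?sn0//; last by apply: diff_derivable; exact: dsf.
have -> : 'D_v (fun y => Num.sqrt (f y)) x = (2 * Num.sqrt (f x))^-1 * 'D_v f x.
  have dss : derivable (fun y => Num.sqrt (f y)) x v.
    exact: diff_derivable (dsf x Ux).
  (* differentiating f = sqrt f * sqrt f gives the derivative of sqrt f *)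
  have -> : 'D_v f x =
      'D_v ((fun y => Num.sqrt (f y)) * (fun y => Num.sqrt (f y))) x.
    apply: near_eq_derive; apply: filterS (open_nbhs_nbhs (conj oU Ux)) => y Uy.
    by rewrite fctE /= -[RHS]expr2 sqr_sqrtr// ltW// f0.
  by rewrite deriveM// /GRing.scale/=; field; rewrite sn0.
by rewrite /GRing.scale/=; field; rewrite sn0.
Qed.

Lemma Ck_row k n (f : V -> 'rV[R]_n) :
  (forall i, Ck k U (fun x => f x 0 i)) -> Ck k U f.
Proof.
elim: k f => [|k IH] f kf.
  have -> : f = fun x => \sum_(i < n) f x 0 i *: delta_mx 0 i.
    by apply/funext => y; exact: row_sum_delta.
  apply: (@Ck_sum _ _ 0 (fun i x => f x 0 i *: delta_mx 0 i)) => i x Ux.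
  by apply: cvgZr_tmp; exact: kf.
have df x : U x -> differentiable f x.
  move=> Ux.
  have -> : f = \sum_(i < n) (fun y => f y 0 i *: delta_mx 0 i).
    by apply/funext => y; rewrite fct_sumE; exact: row_sum_delta.
  by apply: differentiable_sum => i; apply: differentiableZl; exact: (kf i).1.
split=> // v; apply: IH => i.
apply: Ck_ext ((kf i).2 v) => x Ux.
by rewrite derive_mx ?mxE//; apply: diff_derivable; exact: df.
Qed.

End domain.

Lemma Ck_coord n (U : set 'rV[R]_n) (oU : open U) k (i : 'I_n) :
  Ck k U (fun x => x 0 i : R).
Proof.
case: k => [|k]; first by move=> x _; exact: coord_continuous.
have dc x : differentiable (fun y : 'rV[R]_n => y 0 i : R) x.
  exact: differentiable_coord.
split=> // v; rewrite (_ : (fun x => _) = fun=> v 0 i); first exact: Ck_cst.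
apply/funext => x.
have := derive_mx (@derivable_id _ 'rV[R]_n x v).
by move=> /(congr1 (fun M : 'rV[R]_n => M 0 i)); rewrite derive_id mxE.
Qed.

End SmoothCalculus.

Section SmoothMaps.
Context {R : realType} {n : nat} {V : normedModType R} {U : set V}.
Hypothesis oU : open U.

Lemma Ck_component k (f : V -> 'rV[R]_n) i : Ck k U f -> Ck k U (fun x => f x 0 i).
Proof.
elim: k f => [|k IH] f.
  move=> cf x Ux.
  exact: (cvg_comp f (fun y : 'rV[R]_n => y 0 i) (cf x Ux)
    (@coord_continuous _ _ _ _ _ _)).
move=> [df dk]; split=> [x Ux|v].
  apply: (@differentiable_comp _ _ _ _ f (fun y : 'rV[R]_n => y 0 i)).
    exact: df.
  exact: differentiable_coord.
apply: Ck_ext (IH _ (dk v)) => // x Ux.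
by rewrite derive_mx ?mxE//; apply: diff_derivable; exact: df.
Qed.

Lemma CkZ k (a : V -> R) (f : V -> 'rV[R]_n) :
  Ck k U a -> Ck k U f -> Ck k U (fun x => a x *: f x).
Proof.
move=> ka kf; apply: Ck_row => // i.
under eq_fun do rewrite mxE.
by apply: CkM => //; exact: Ck_component.
Qed.

Lemma Ck_dot k (f g : V -> 'rV[R]_n) :
  Ck k U f -> Ck k U g -> Ck k U (fun x => dot (f x) (g x)).
Proof.
move=> kf kg; apply: Ck_sum => // i.
by apply: CkM => //; exact: Ck_component.
Qed.

Lemma Ck_rescale k (d : 'I_n -> R) (f : V -> 'rV[R]_n) :
  Ck k U f -> Ck k U (fun x => rescale d (f x)).
Proof.
move=> kf; apply: Ck_row => // i; under eq_fun do rewrite mxE.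
by apply: CkM => //; [exact: Ck_cst|exact: Ck_component].
Qed.

End SmoothMaps.

Lemma Ck_id {R : realType} {n : nat} (U : set 'rV[R]_n) k : open U -> Ck k U id.
Proof. by move=> oU; apply: Ck_row => // i; exact: Ck_coord. Qed.

(** * Derivatives along directions and along curves *)

Section Tangent.
Context {R : realType} {n : nat} {W : normedModType R}.
Implicit Types (S : set 'rV[R]_n) (f : 'rV[R]_n -> W).

(** Near time 0, on the right, f is constant along the curve, so the right limit of
the difference quotients of f o gamma is 0; by the chain rule that limit is also
the derivative of f along the velocity. *)
Lemma derive_curve_velocity S p v f : differentiable f p ->
  (\forall x \near p, S x -> f x = f p) -> curve_velocity S p v -> 'D_v f p = 0.
Proof.
move=> df fS [gamma [[dg gv] g0 Sg]].
have dgam : differentiable gamma 0 by apply/derivable1_diffP.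
have dfg : differentiable f (gamma 0) by rewrite g0.
have dcomp := differentiable_comp dgam dfg.
have <- : 'D_1 (f \o gamma) 0 = 'D_v f p.
  rewrite deriveE// [RHS]deriveE// (diff_comp dgam dfg)/= g0.
  by rewrite -gv (deriveE _ dgam).
have cfg :
    (h^-1 *: ((f \o gamma) (h *: 1 + 0) - (f \o gamma) 0)) @[h --> (0 : R)^'+]
    --> 'D_1 (f \o gamma) 0.
  apply: cvg_dnbhs_at_right. 
  have dfg1 : derivable (f \o gamma) 0 1 by exact: diff_derivable.
  exact: dfg1.
suff : (h^-1 *: ((f \o gamma) (h *: 1 + 0) - (f \o gamma) 0)) @[h --> (0 : R)^'+]
    --> (0 : W).
  by move=> /cvg_lim <-//; apply/esym/cvg_lim.
apply: cvg_near_cst.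
have cg : gamma @ (0 : R)^'+ --> p.
  by rewrite -g0; apply: cvg_at_right_filter; exact: differentiable_continuous.
have fS' : \forall h \near (0 : R)^'+, S (gamma h) -> f (gamma h) = f p.
  exact: cg fS.
near=> h.
rewrite /= addr0 [_ *: 1]mulr1 g0 (near fS' h) ?subrr ?scaler0//.
exact: (near Sg h).
Unshelve. all: by end_near. Qed.

Lemma derive_tangent S p v f : differentiable f p ->
  (\forall x \near p, S x -> f x = f p) -> tangent S p v -> 'D_v f p = 0.
Proof.
move=> df fS [|]; first exact: derive_curve_velocity.
move=> /(derive_curve_velocity df fS); rewrite !deriveE// linearN => /eqP.
by rewrite oppr_eq0 => /eqP.
Qed.

End Tangent.

Section Derivatives.
Context {R : realType} {V W : normedModType R}.

(** Maps that are polynomial of degree at most two on lines can be differentiated by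
reading off the linear term. *)
Lemma derive_quadratic (f : V -> W) p v w w' :
  (forall h, f (h *: v + p) = f p + h *: (w + h *: w')) -> 'D_v f p = w.
Proof.
move=> fE; apply/cvg_lim => //.
have -> : w = w + (0 : R) *: w' by rewrite scale0r addr0.
apply: cvg_trans (_ : (fun h : R => w + h *: w') @ 0^' --> _); last first.
  apply: cvg_within_filter.
  by apply: cvgD; [exact: cvg_cst|apply: cvgZr_tmp; exact: cvg_id].
apply: near_eq_cvg; near=> h.
have h0 : h != 0 by near: h; exact: nbhs_dnbhs_neq.
by rewrite /= fE [f p + _]addrC addrK scalerA mulVf// scale1r.
Unshelve. all: by end_near. Qed.

Lemma derive_dot n (N : V -> 'rV[R]_n) p v w : differentiable N p ->
  'D_v (fun x => dot (N x) w) p = dot ('D_v N p) w.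
Proof.
move=> dN; rewrite derive_mx; last exact: diff_derivable.
rewrite /dot -[LHS]/('D_v (fun x => \sum_i N x 0 i * w 0 i) p).
have dNi i : derivable (fun x => N x 0 i) p v.
  by apply: (derivable_mxP N p v).1; exact: diff_derivable.
rewrite -(fct_sumE _ _ (fun i x => N x 0 i * w 0 i)) derive_sum => [|i].
  by apply: eq_bigr => i _; rewrite deriveMr// mxE mulrC.
by apply: derivableM => //; exact: derivable_cst.
Qed.

End Derivatives.

(** * Bounded and connected sets of row vectors *)

Section Topology.
Context {R : realType}.

Lemma bounded_coord n (A : set 'rV[R]_n) (B : R) :
  (forall x i, A x -> `|x 0 i| <= B) -> bounded_set A.
Proof.
move=> AB; exists `|B|; split; first exact: num_real.
move=> M BM x Ax /=; rewrite [leLHS]/Num.Def.normr/= mx_normrE.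
apply: bigmax_le; first by rewrite (le_trans _ (ltW BM)).
move=> [i j] _ /=; rewrite (ord1 i) (le_trans (AB x j Ax))//.
by rewrite (le_trans (ler_norm B))// ltW.
Qed.

Lemma bounded_coordP n (A : set 'rV[R]_n) : bounded_set A ->
  exists B, forall x i, A x -> `|x 0 i| <= B.
Proof.
move=> [M [_ MA]]; exists (M + 1) => x i Ax.
apply: le_trans (MA (M + 1) _ x Ax); last by rewrite ltrDl.
rewrite [leRHS]/Num.Def.normr/= mx_normrE.
exact: (le_bigmax _ (fun ij : 'I_1 * 'I_n => `|x ij.1 ij.2|) (0, i)).
Qed.

Lemma connected_segment n (x y : 'rV[R]_n) :
  connected ((fun t : R => x + t *: y) @` `[0, 1]).
Proof.
apply: connected_continuous_connected; first exact: segment_connected.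
apply: continuous_subspaceT => t.
by apply: cvgD; [exact: cvg_cst|apply: cvgZr_tmp].
Qed.

(** A union of segments with the common endpoint a. *)
Lemma connected_starshaped n (A : set 'rV[R]_n) (a : 'rV[R]_n) : A a ->
  (forall x t, A x -> 0 <= t <= 1 -> A (a + t *: (x - a))) -> connected A.
Proof.
move=> Aa starA.
have -> : A = \bigcup_(x in A) ((fun t : R => a + t *: (x - a)) @` `[0, 1]).
  apply/seteqP; split => [x Ax|_ [x Ax [t t01 <-]]]; last exact: starA.
  exists x => //; exists 1; first by rewrite /= in_itv/= ler01 lexx.
  by rewrite scale1r addrC subrK.
apply: bigcup_connected; last by move=> x _; exact: connected_segment.
exists a => x _; exists 0; first by rewrite /= in_itv/= ler01 lexx.
by rewrite scale0r addr0.
Qed.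

Lemma connected_halfline n (x y : 'rV[R]_n) :
  connected ((fun t : R => x + t *: y) @` `[0, +oo[).
Proof.
apply: connected_continuous_connected.
  by apply/connected_intervalP; exact: interval_is_interval.
apply: continuous_subspaceT => t.
by apply: cvgD; [exact: cvg_cst|apply: cvgZr_tmp].
Qed.

End Topology.

(** * Lower bounds for volumes of sets containing a box *)

Section BoxVolume.
Context {R : realType}.

Lemma integral_scaled_indic (K a b : R) : 0 <= K -> a <= b ->
  (\int[lebesgue_measure]_t (K * \1_(`[a, b]%classic) t)%:E = (K * (b - a))%:E)%E.
Proof.
move=> K0 ab; under eq_integral do rewrite EFinM.
rewrite ge0_integralZl_EFin//; first last.
  by apply/measurable_EFinP; exact: measurable_indic.
rewrite integral_indic// setIT /=.
rewrite lebesgue_measure_itv/= lte_fin; case: ltP => ba; first by rewrite EFinM.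
by rewrite (@le_anti _ _ a b) ?ab// subrr mule0 mulr0.
Qed.

(** Integrating the inequality between indicators, one variable at a time: freeze the
last coordinate t, absorb the indicators of t into the weights C and c k, apply the
case of dimension n, and integrate the result in t. The weights are there for this
induction. *)
Lemma sum_prod_side_ge n (C : R) (a b c : nat -> R) (A B : nat -> nat -> R) :
  0 <= C -> (forall i, a i <= b i) ->
  (forall k, 0 <= c k) -> (forall k i, A k i <= B k i) ->
  (forall x : nat -> R,
    (C * \prod_(i < n) \1_(`[a i, b i]%classic) (x i))%:E <=
    \sum_(k <oo) (c k * \prod_(i < n) \1_(`[A k i, B k i]%classic) (x i))%:E)%E ->
  ((C * \prod_(i < n) (b i - a i))%:E <=
   \sum_(k <oo) (c k * \prod_(i < n) (B k i - A k i))%:E)%E.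
Proof.
elim: n C c => [|n IH] C c C0 ab c0 AB cover.
  have := cover (fun=> 0); rewrite !big_ord0.
  under eq_eseriesr do rewrite big_ord0.
  by under [in X in _ -> X]eq_eseriesr do rewrite big_ord0.
pose P := \prod_(i < n) (b i - a i).
pose p k := \prod_(i < n) (B k i - A k i).
have P0 : 0 <= P by apply: prodr_ge0 => i _; rewrite subr_ge0.
have p0 k : 0 <= p k by apply: prodr_ge0 => i _; rewrite subr_ge0.
have slice t : ((C * P * \1_(`[a n, b n]%classic) t)%:E <=
    \sum_(k <oo) (c k * p k * \1_(`[A k n, B k n]%classic) t)%:E)%E.
  rewrite mulrAC; under eq_eseriesr do rewrite mulrAC.
  apply: IH => // [|k|x]; [exact: mulr_ge0|exact: mulr_ge0|].
  have := cover (fun i => if i == n then t else x i).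
  rewrite big_ord_recr/= eqxx.
  under eq_eseriesr do rewrite big_ord_recr/= eqxx mulrA mulrAC.
  rewrite mulrA mulrAC.
  have lt_neq (i : 'I_n) : (i == n :> nat) = false by rewrite ltn_eqF.
  under eq_bigr do rewrite lt_neq.
  by under eq_eseriesr do under eq_bigr do rewrite lt_neq.
have mi (K u v : R) :
    measurable_fun setT (fun s => (K * \1_(`[u, v]%classic) s)%:E).
  by apply/measurable_EFinP/measurable_funM => //; exact: measurable_indic.
have : (\int[lebesgue_measure]_t (C * P * \1_(`[a n, b n]%classic) t)%:E <=
  \int[lebesgue_measure]_t
    \sum_(k <oo) (c k * p k * \1_(`[A k n, B k n]%classic) t)%:E)%E.
  apply: ge0_le_integral => //.
  - by move=> t _; rewrite lee_fin !mulr_ge0.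
  - exact: mi.
  - by apply: ge0_emeasurable_sum => k *; [rewrite lee_fin !mulr_ge0|exact: mi].
rewrite integral_nneseries//; first last.
- by move=> k t _; rewrite lee_fin !mulr_ge0.
- by move=> k; exact: mi.
under eq_eseriesr do rewrite integral_scaled_indic ?mulr_ge0//.
rewrite integral_scaled_indic ?mulr_ge0// big_ord_recr/= mulrA.
by under [in X in _ -> X]eq_eseriesr do rewrite big_ord_recr/= mulrA.
Qed.

(** A countable cover of a box by boxes is an inequality between their indicators. *)
Lemma vol_box_ge n (a b : 'rV[R]_n) (A : set 'rV[R]_n) :
  (forall i, a 0 i <= b 0 i) -> box a b `<=` A ->
  ((\prod_i (b 0 i - a 0 i))%:E <= vol A)%E.
Proof.
move=> ab abA; apply: le_ereal_inf_tmp => _ [a' [b' [ab' cov ->]]].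
(* coordinates indexed by nat, with default value 0, to use the induction above *)
pose ext (x : 'rV[R]_n) (i : nat) := if insub i is Some j then x 0 j else 0.
have extE x (i : 'I_n) : ext x i = x 0 i by rewrite /ext valK.
have le_ext (x y : 'rV[R]_n) : (forall i, x 0 i <= y 0 i) ->
    forall i, ext x i <= ext y i.
  by move=> xy i; rewrite /ext; case: insub.
have prodE (u v : 'rV[R]_n) :
    \prod_(i < n) (ext v i - ext u i) = \prod_i (v 0 i - u 0 i).
  by apply: eq_bigr => i _; rewrite !extE.
suff : ((1 * \prod_(i < n) (ext b i - ext a i))%:E <=
    \sum_(k <oo) (1 * \prod_(i < n) (ext (b' k) i - ext (a' k) i))%:E)%E.
  by rewrite mul1r prodE; under eq_eseriesr do rewrite mul1r prodE.
apply: (@sum_prod_side_ge n 1 (ext a) (ext b) (fun=> 1)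
  (fun k => ext (a' k)) (fun k => ext (b' k))) => // [i|k i|x].
- exact: le_ext.
- by apply: le_ext => j; exact: ab'.
rewrite mul1r.
pose y : 'rV[R]_n := \row_i x i.
have indic01 (u v t : R) : (\1_(`[u, v]%classic) t : R) = (u <= t <= v)%R%:R.
  by rewrite indicE mem_setE in_itv.
have prod01 (u v : 'rV[R]_n) : \prod_(i < n) \1_(`[ext u i, ext v i]%classic) (x i)
    = (`[< box u v y >])%:R :> R.
  case: asboolP => [uvy|nuvy].
    rewrite big1// => i _; rewrite indic01 !extE.
    by have := uvy i; rewrite mxE => ->.
  have [i /negP uvi] : exists i, ~ (u 0 i <= y 0 i <= v 0 i) by exact/existsNP.
  rewrite (bigD1 i)//= indic01 !extE.
  by move: uvi; rewrite mxE => /negbTE ->; rewrite mul0r.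
rewrite prod01; under eq_eseriesr do rewrite mul1r prod01.
case: asboolP => [yab|_]; last by apply: nneseries_ge0 => k _ _; rewrite lee_fin.
have [k _ yk] := cov _ (abA _ yab).
apply: le_trans (nneseries_lim_ge k.+1 _) => [|j _ _]; last by rewrite lee_fin.
rewrite big_nat_recr//= (asboolT yk) lee_paddl// sume_ge0// => j _.
Qed.

End BoxVolume.

Section VerticalBoxes.
Context {R : realType} {m : nat}.
Local Notation n := m.+2.
Local Notation rV := 'rV[R]_n.

Lemma vol_vertical_box_ge (A : set rV) (a b h k : R) : a <= b -> h <= k ->
  (forall x : rV, (forall i, i != ord_max -> a <= x 0 i <= b) ->
    h <= x 0 ord_max <= k -> A x) ->
  (((b - a) ^+ m.+1 * (k - h))%:E <= vol A)%E.
Proof.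
move=> ab hk subA.
pose corner (u v : R) : rV := \row_i if i == ord_max then v else u.
have := @vol_box_ge R n (corner a h) (corner b k) A.
rewrite big_ord_recr/= !mxE eqxx (eq_bigr (fun=> b - a)) => [|i _]; last first.
  by rewrite !mxE -val_eqE/= ltn_eqF.
rewrite prodr_const card_ord; apply=> [i|x xb].
  by rewrite !mxE; case: ifP.
apply: subA => [i im|]; last by have := xb ord_max; rewrite !mxE eqxx.
by have := xb i; rewrite !mxE (negbTE im).
Qed.

Lemma dot_split (x : rV) :
  dot x x = \sum_(i < n | i != ord_max) x 0 i ^+ 2 + height x ^+ 2.
Proof. by rewrite /dot (bigD1 ord_max)//= -expr2 -heightE addrC. Qed.

Lemma sum_sqr_le (x : rV) (b : R) : (forall i, i != ord_max -> x 0 i ^+ 2 <= b) ->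
  \sum_(i < n | i != ord_max) x 0 i ^+ 2 <= m.+1%:R * b.
Proof.
move=> xb; apply: le_trans (ler_sum _ xb) _.
by rewrite sumr_const cardC1 card_ord mulr_natl.
Qed.

End VerticalBoxes.

(** * The truncated ellipsoid and the region it encloses *)

Section Ellipsoid.
Context {R : realType} {m : nat}.
Local Notation n := m.+2.
Local Notation rV := 'rV[R]_n.
Implicit Types (x y z w p : rV).
Context (e z0 : R).
Hypotheses (e0 : 0 < e) (z00 : 0 < z0).
Local Notation quad := (quadric e z0).
Local Notation cen := (center z0).
Local Notation wd := (wdot e).

Definition ellipsoid_cap : set rV := [set x | 0 <= height x /\ quad x = 1].
Definition ellipsoid_rim : set rV := [set x | height x = 0 /\ quad x = 1].
Definition ellipsoid_solid : set rV := [set x | 0 <= height x /\ quad x <= 1].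
Definition ellipsoid_inside : set rV := [set x | 0 < height x /\ quad x < 1].

Lemma Ck_quadric k (U : set rV) : open U -> Ck k U quad.
Proof.
move=> oU; have kf : Ck k U (fun x : rV => x - cen).
  by apply: CkD => //; [exact: Ck_id|exact: Ck_cst].
by apply: Ck_dot => //; exact: Ck_rescale.
Qed.

Lemma quadric_continuous : continuous (quad : rV -> R).
Proof. by move=> x; exact: (@Ck_quadric 0%N setT openT x I). Qed.

Lemma height_continuous : continuous (height : rV -> R).
Proof.
rewrite (_ : height = fun x : rV => x 0 ord_max); last first.
  by apply/funext => x; exact: heightE.
exact: coord_continuous.
Qed.

Lemma height_center : height (cen : rV) = z0.
Proof. by rewrite heightE /center mxE En_max mulr1. Qed.

Lemma quad_center : quad (cen : rV) = 0.
Proof. by rewrite /quadric subrr -(scale0r (cen : rV)) wdotZl mul0r. Qed.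

Lemma closed_solid : closed ellipsoid_solid.
Proof.
have -> : ellipsoid_solid =
    (height @^-1` [set r | 0 <= r]) `&` (quad @^-1` [set r | r <= 1]).
  by apply/seteqP; split.
apply: closedI; apply: preimage_closed.
- by move=> x _; exact: height_continuous.
- exact: closed_ge.
- by move=> x _; exact: quadric_continuous.
- exact: closed_le.
Qed.

Lemma open_inside : open ellipsoid_inside.
Proof.
have -> : ellipsoid_inside =
    (height @^-1` [set r | 0 < r]) `&` (quad @^-1` [set r | r < 1]).
  by apply/seteqP; split.
apply: openI; apply: open_comp.
- by move=> x _; exact: height_continuous.
- exact: open_gt.
- by move=> x _; exact: quadric_continuous.
- exact: open_lt.
Qed.

Lemma bounded_solid : bounded_set ellipsoid_solid.
Proof.
pose C := 1 + e^-1.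
have eV : 0 < e^-1 by rewrite invr_gt0.
apply: (@bounded_coord _ _ _ (z0 + C)) => x i [_ Qx].
have := le_trans (dot_rescale_sq_coord (x - cen) i (weight_gt0 e0)) Qx.
set u := (x - cen) 0 i => wu.
have u2 : u ^+ 2 <= C.
  move: wu; rewrite /weight; case: ifP => _ wu; last by rewrite /C; lra.
  have : e^-1 * (e * u ^+ 2) <= e^-1 * 1 by rewrite ler_pM2l.
  by rewrite mulKf ?gt_eqF// mulr1 /C; lra.
have uC : `|u| <= C.
  rewrite ler_norml; apply/andP; split; rewrite /C in u2 *; nra.
have -> : x 0 i = u + cen 0 i by rewrite /u !mxE; ring.
rewrite (le_trans (ler_normD _ _))// addrC lerD// /center !mxE.
by case: eqP => _; rewrite ?mulr1 ?mulr0 ?normr0 ?gtr0_norm// ltW.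
Qed.

Lemma compact_solid : compact ellipsoid_solid.
Proof. exact: bounded_closed_compact bounded_solid closed_solid. Qed.

Lemma compact_cap : compact ellipsoid_cap.
Proof.
apply: (subclosed_compact _ compact_solid); last first.
  by move=> x [? Qx]; split; rewrite ?Qx.
have -> : ellipsoid_cap = ellipsoid_solid `&` (quad @^-1` [set r | r = 1]).
  apply/seteqP; split => [x [? Qx]|x [[? _] ?]//].
  by split => //; split; rewrite ?Qx.
apply: closedI; [exact: closed_solid|apply: preimage_closed].
- by move=> x _; exact: quadric_continuous.
- exact: closed_eq.
Qed.

Lemma heightD x y : height (x + y) = height x + height y.
Proof. exact: dotDl. Qed.

Lemma heightZ k x : height (k *: x) = k * height x.
Proof. exact: dotZl. Qed.

Lemma quad_convex t x y : 0 <= t <= 1 ->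
  quad (t *: x + (1 - t) *: y) <= t * quad x + (1 - t) * quad y.
Proof.
move=> /andP[t0 t1]; have tt : 0 <= t * (1 - t) by rewrite mulr_ge0// subr_ge0.
rewrite /quadric.
have -> : t *: x + (1 - t) *: y - cen = t *: (x - cen) + (1 - t) *: (y - cen).
  by apply/rowP => i; rewrite !mxE; ring.
move: (x - cen) (y - cen) => a b.
have := mulr_ge0 tt (wdot_ge0 e0 (a - b)).
rewrite !(wdotDl, wdotDr, wdotNl, wdotNr, wdotZl, wdotZr) (wdotC e b a).
by move: (wd a a) (wd a b) (wd b b) => A B C; lra.
Qed.

Lemma convex_solid : convex_set ellipsoid_solid.
Proof.
move=> x y l; rewrite !inE => -[hx Qx] [hy Qy].
have l0 : 0 <= l%:num by []. 
have l1 : l%:num <= 1 by [].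
suff : ellipsoid_solid (l%:num *: (x : rV) + (1 - l%:num) *: (y : rV)) by [].
split; first by rewrite heightD !heightZ addr_ge0// mulr_ge0// subr_ge0.
by apply: le_trans (quad_convex _ _ _) _; [rewrite l0 l1|nra].
Qed.

Lemma inside_sub_solid : ellipsoid_inside `<=` ellipsoid_solid.
Proof. by move=> x [hx Qx]; split; exact: ltW. Qed.

Lemma inside_center : ellipsoid_inside cen.
Proof. by split; rewrite ?height_center ?quad_center. Qed.

Lemma convex_body_solid : convex_body ellipsoid_solid.
Proof.
split; [exact: compact_solid|exact: convex_solid|exists cen].
have : nbhs (cen : rV) ellipsoid_inside.
  by apply: open_nbhs_nbhs; split; [exact: open_inside|exact: inside_center].
by apply: filterS; exact: inside_sub_solid.
Qed.

(** Moving from x towards the centre strictly decreases the quadric and makes the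
height positive, by convexity. *)
Lemma inside_starshaped x t : ellipsoid_solid x -> 0 < t <= 1 ->
  ellipsoid_inside (x + t *: (cen - x)).
Proof.
move=> [hx Qx] /andP[t0 t1].
have -> : x + t *: (cen - x) = t *: cen + (1 - t) *: x.
  by apply/rowP => i; rewrite !mxE; ring.
split.
  rewrite /= heightD (heightZ t) (heightZ (1 - t)) height_center.
  by rewrite ltr_pwDl ?mulr_gt0// mulr_ge0// subr_ge0.
apply: le_lt_trans (quad_convex _ _ _) _; first by rewrite ltW.
have : (1 - t) * quad x <= (1 - t) * 1 by rewrite ler_wpM2l// subr_ge0.
by rewrite quad_center; lra.
Qed.

Lemma closure_inside : closure ellipsoid_inside = ellipsoid_solid.
Proof.
apply/seteqP; split.
  rewrite [X in _ `<=` X]((closure_id _).1 closed_solid).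
  exact/closureS/inside_sub_solid.
move=> x Sx A /= Ax.
have cv : (x + t *: (cen - x)) @[t --> (0 : R)^'+] --> x.
  have : (x + t *: (cen - x)) @[t --> (0 : R)] --> x + 0 *: (cen - x).
    by apply: cvgD; [exact: cvg_cst|apply: cvgZr_tmp].
  by rewrite scale0r addr0; exact: cvg_at_right_filter.
have : \forall t \near (0 : R)^'+, A (x + t *: (cen - x)) by exact: cv.
have : \forall t \near (0 : R)^'+, 0 < t <= 1.
  by near=> t; apply/andP; split => //; near: t; exact: nbhs_right_le.
have near_ex := @filter_ex _ _ (at_right_proper_filter (0 : R)).
move=> /filterI/[apply]/near_ex [t [t01 At]].
by exists (x + t *: (cen - x)); split => //; exact: inside_starshaped.
Unshelve. all: by end_near. Qed.

(** The image of the component under the quadric is an interval of the real line that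
misses 1 and contains quad x < 1. *)
Lemma component_inside x : (upper_half_space `\` ellipsoid_cap) x -> quad x < 1 ->
  connected_component (upper_half_space `\` ellipsoid_cap) x `<=` ellipsoid_inside.
Proof.
move=> Hx Qx y Cy; have [hy nSy] := connected_component_sub Cy.
have conQ : connected (quad @` connected_component (upper_half_space `\` ellipsoid_cap) x).
  apply: connected_continuous_connected; first exact: component_connected.
  exact/continuous_subspaceT/quadric_continuous.
split => //; rewrite /= ltNge; apply/negP => Qy.
have /connected_intervalP iQ := conQ.
have [w Cw Qw] : (quad @` connected_component (upper_half_space `\` ellipsoid_cap) x) 1.
  apply: (iQ (quad x) (quad y)); last by rewrite (ltW Qx).
  - by exists x => //; exact: connected_component_refl.
  - by exists y.
have [hw] := connected_component_sub Cw.
by apply; split => //; exact: ltW.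
Qed.

Lemma quad_horizontal x k :
  quad (x + k *: delta_mx 0 0) = quad x + 2 * k * x 0 0 + k ^+ 2.
Proof.
rewrite !quadricE wdotDl (wdotDr _ _ (k *: delta_mx 0 0)).
rewrite (wdotC e (k *: delta_mx 0 0)).
by rewrite !wdotZr !wdot_coord0 !mxE/= !mulr0 mulr1 !addr0; ring.
Qed.

(** A horizontal half-line from x along the first axis, in the direction of the sign of
the first coordinate of x, keeps the height and does not decrease the quadric. *)
Lemma component_outside x : (upper_half_space `\` ellipsoid_cap) x -> 1 < quad x ->
  ~ bounded_set (connected_component (upper_half_space `\` ellipsoid_cap) x).
Proof.
move=> Hx Qx /bounded_coordP [B bB]; have [hx _] := Hx.
pose sg : R := if 0 <= x 0 0 then 1 else -1.
have sgx : sg * x 0 0 = `|x 0 0|.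
  rewrite /sg; case: leP => x0; first by rewrite mul1r ger0_norm.
  by rewrite mulN1r ltr0_norm.
have sg2 : sg ^+ 2 = 1 by rewrite /sg; case: ifP => _; rewrite ?sqrrN expr1n.
pose ray (t : R) := x + t *: (sg *: delta_mx 0 0 : rV).
have sub : ray @` `[0, +oo[ `<=` connected_component (upper_half_space `\` ellipsoid_cap) x.
  apply: connected_component_max; last exact: connected_halfline.
    by exists 0; rewrite /ray ?scale0r ?addr0//= in_itv/= lexx.
  move=> _ [t + <-]; rewrite /= in_itv/= andbT => t0; split.
    by rewrite /upper_half_space/= heightE !mxE/= !mulr0 addr0 -heightE.
  move=> [_]; rewrite /ray scalerA quad_horizontal => Q1.
  have : 0 <= 2 * (t * sg) * x 0 0 by rewrite -!mulrA sgx !mulr_ge0.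
  by have := sqr_ge0 (t * sg); lra.
have t0 : 0 <= `|B| + 1 by rewrite addr_ge0.
have := bB (ray (`|B| + 1)) 0; apply/not_implyP; split.
  by apply: sub; exists (`|B| + 1); rewrite //= in_itv/= t0.
apply/negP; rewrite -ltNge (le_lt_trans (ler_norm B))//.
have -> : ray (`|B| + 1) 0 0 = sg * (`|x 0 0| + (`|B| + 1)).
  rewrite !mxE/= mulr1 mulrDr -sgx mulrA -expr2 sg2 mul1r.
  by rewrite mulrC.
have sg1 : `|sg| = 1.
  by apply/eqP; rewrite -(@eqrXn2 _ 2%N)// expr1n -normrX sg2 normr1.
rewrite normrM sg1.
rewrite mul1r ger0_norm ?addr_ge0//.
by have := normr_ge0 (x 0 0); lra.
Qed.

Lemma enclosed_region_cap : enclosed_region ellipsoid_cap = ellipsoid_solid.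
Proof.
rewrite -closure_inside /enclosed_region; congr closure; apply/seteqP; split.
  move=> x [Hx bC]; have [hx nS] := Hx.
  have [Q1|Q1|Q1] := ltgtP (quad x) 1; first by split.
    by have := component_outside Hx Q1 bC.
  by exfalso; apply: nS; split => //; exact: ltW.
move=> x [hx Qx].
have Hx : (upper_half_space `\` ellipsoid_cap) x.
  by split => // -[_]; move: Qx => /[swap] ->; rewrite ltxx.
have [B bB] := bounded_coordP bounded_solid.
split => //; apply: (@bounded_coord _ _ _ B) => y i Cy.
exact/bB/inside_sub_solid/(component_inside Hx Qx).
Qed.

End Ellipsoid.

(** * Charts by inversion *)

Section Charts.
Context {R : realType} {m : nat}.
Local Notation n := m.+2.
Local Notation rV := 'rV[R]_n.
Implicit Types (x y z w p : rV).
Context (e z0 rho : R).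
Hypothesis e0 : 0 < e.
Hypothesis rho1 : rho ^+ 2 + e * z0 ^+ 2 = 1.
Local Notation quad := (quadric e z0).
Local Notation cen := (center z0).
Local Notation wd := (wdot e).
Local Notation cap := (@ellipsoid_cap R m e z0).
Local Notation rim := (@ellipsoid_rim R m e z0).
Local Notation E0 := (delta_mx 0 0 : rV).

(** Inversion in the quadratic form of the ellipsoid: an involution outside 0 that
maps the translates of the ellipsoid through 0 to hyperplanes. *)
Definition inversion y : rV := (wd y y)^-1 *: y.

Lemma inversionE y i : inversion y 0 i = (wd y y)^-1 * y 0 i.
Proof. by rewrite mxE. Qed.

Lemma wdot_inversion y : y != 0 -> wd (inversion y) (inversion y) = (wd y y)^-1.
Proof.
move=> y0; rewrite /inversion wdotZl wdotZr mulVf ?mulr1//.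
by rewrite gt_eqF// wdot_gt0.
Qed.

Lemma inversionK y : y != 0 -> inversion (inversion y) = y.
Proof.
move=> y0; rewrite {1}/inversion wdot_inversion// invrK /inversion scalerA.
rewrite mulfV ?scale1r//.
by rewrite gt_eqF// wdot_gt0.
Qed.

Lemma inversion_neq0 y : y != 0 -> inversion y != 0.
Proof.
by move=> y0; rewrite scaler_eq0 negb_or y0 andbT invr_eq0 gt_eqF// wdot_gt0.
Qed.

Context (q : R).
Hypotheses (q0 : q != 0) (q2 : q ^+ 2 = rho ^+ 2).

Definition pole : rV := q *: E0.

(** After inversion at the pole the ellipsoid has equation
1 + 2 q z_0 - 2 e z0 z_n = 0. This affine bijection makes the left-hand side the
first coordinate and keeps the other coordinates. *)
Definition flatten z : rV :=
  z + (1 + (2 * q - 1) * z 0 0 - 2 * e * z0 * z 0 ord_max) *: E0.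

Definition unflatten w : rV :=
  w + ((2 * q)^-1 * (w 0 0 - 1 + 2 * e * z0 * w 0 ord_max) - w 0 0) *: E0.

Definition chart x := flatten (inversion (x - pole)).
Definition unchart w := pole + inversion (unflatten w).

Lemma flatten_max z : flatten z 0 ord_max = z 0 ord_max.
Proof. by rewrite !mxE/= mulr0 addr0. Qed.

Lemma unflatten_max w : unflatten w 0 ord_max = w 0 ord_max.
Proof. by rewrite !mxE/= mulr0 addr0. Qed.

Lemma flatten_0 z : flatten z 0 0 = 1 + 2 * q * z 0 0 - 2 * e * z0 * z 0 ord_max.
Proof. by rewrite !mxE/=; ring. Qed.

Lemma unflatten_0 w :
  unflatten w 0 0 = (2 * q)^-1 * (w 0 0 - 1 + 2 * e * z0 * w 0 ord_max).
Proof. by rewrite !mxE/=; ring. Qed.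

Lemma flattenK : cancel flatten unflatten.
Proof.
move=> z; rewrite {1}/unflatten flatten_0 flatten_max /flatten -addrA -scalerDl.
rewrite [X in X *: _](_ : _ = 0) ?scale0r ?addr0//.
by field.
Qed.

Lemma unflattenK : cancel unflatten flatten.
Proof.
move=> w; rewrite {1}/flatten unflatten_0 unflatten_max /unflatten -addrA -scalerDl.
rewrite [X in X *: _](_ : _ = 0) ?scale0r ?addr0//.
by field.
Qed.

Lemma pole_max : pole 0 ord_max = 0.
Proof. by rewrite !mxE/= mulr0. Qed.

(** The pole lies on the ellipsoid since q^2 + e z0^2 = 1, whence the constant term 1. *)
Lemma quad_pole y :
  quad (pole + y) = 1 + wd y y + 2 * q * y 0 0 - 2 * e * z0 * y 0 ord_max.
Proof.
rewrite addrC quad_horizontal q2 quadricE.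
move: rho1; lra.
Qed.

Lemma chart_0 x : x != pole ->
  chart x 0 0 = (quad x - 1) / wd (x - pole) (x - pole).
Proof.
rewrite -subr_eq0 => xp; have w0 := wdot_gt0 e0 xp.
rewrite /chart flatten_0 !inversionE.
have := quad_pole (x - pole); rewrite [pole + _]addrC subrK => ->.
move: (x - pole) w0 => y w0.
by field; rewrite gt_eqF.
Qed.

Lemma chart_max x : chart x 0 ord_max = height x / wd (x - pole) (x - pole).
Proof.
rewrite /chart flatten_max inversionE mulrC heightE.
by congr (_ / _); rewrite [LHS]mxE [X in _ + X]mxE pole_max subr0.
Qed.

Lemma chartK x : x != pole -> unchart (chart x) = x.
Proof.
by rewrite -subr_eq0 => xp; rewrite /unchart /chart flattenK inversionK// addrC subrK.
Qed.

Lemma unchartK w : unflatten w != 0 -> chart (unchart w) = w.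
Proof.
by move=> w0; rewrite /unchart /chart [pole + _]addrC addrK inversionK// unflattenK.
Qed.

Lemma unchart_pole w : unflatten w != 0 -> unchart w != pole.
Proof.
by move=> w0; rewrite -subr_eq0 /unchart [pole + _]addrC addrK inversion_neq0.
Qed.

Lemma unflatten_chart x : x != pole -> unflatten (chart x) != 0.
Proof. by move=> xp; rewrite /chart flattenK inversion_neq0// subr_eq0. Qed.

(** The chart turns both equations, of the ellipsoid and of the hyperplane, into
coordinate functions up to the positive factor wd (x - pole) (x - pole). *)
Lemma cap_chart x : x != pole ->
  cap x <-> chart x 0 0 = 0 /\ 0 <= chart x 0 ord_max.
Proof.
move=> xp; have w0 : 0 < wd (x - pole) (x - pole) by rewrite wdot_gt0// subr_eq0.
rewrite chart_0// chart_max pmulr_lge0 ?invr_gt0//; split => [[hx ->]|[/eqP + hx]].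
  by rewrite subrr mul0r.
by rewrite mulf_eq0 invr_eq0 (gt_eqF w0) orbF subr_eq0 => /eqP.
Qed.

Lemma Ck_inversion k (U : set rV) (f : rV -> rV) : open U ->
  (forall x, U x -> f x != 0) ->
  Ck k U f -> Ck k U (fun x => inversion (f x)).
Proof.
move=> oU f0 kf; apply: CkZ => //; apply: CkV => //.
  by move=> x Ux; rewrite gt_eqF// wdot_gt0// f0.
by apply: Ck_dot => //; exact: Ck_rescale.
Qed.

Lemma Ck_affine_coords k (U : set rV) (f : rV -> rV) (a b c : R) :
  open U -> Ck k U f ->
  Ck k U (fun x => f x + (a + b * f x 0 0 + c * f x 0 ord_max) *: E0).
Proof.
move=> oU kf; apply: CkD => //; apply: CkZ => //; last exact: Ck_cst.
by do 2?[apply: CkD => //]; try apply: CkM => //;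
  first [exact: Ck_cst|exact: Ck_component].
Qed.

Lemma Ck_flatten k (U : set rV) (f : rV -> rV) : open U -> Ck k U f ->
  Ck k U (fun x => flatten (f x)).
Proof.
move=> oU /(Ck_affine_coords 1 (2 * q - 1) (- (2 * e * z0)) oU).
by apply: Ck_ext => // x _; rewrite /flatten mulNr.
Qed.

Lemma Ck_unflatten k (U : set rV) (f : rV -> rV) : open U -> Ck k U f ->
  Ck k U (fun x => unflatten (f x)).
Proof.
move=> oU.
move=> /(Ck_affine_coords (- (2 * q)^-1) ((2 * q)^-1 - 1)
  ((2 * q)^-1 * (2 * e * z0)) oU).
apply: Ck_ext => // x _; rewrite /unflatten; congr (_ + _ *: _); ring.
Qed.

Lemma smooth_chart (U : set rV) : open U -> ~ U pole -> smooth U chart.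
Proof.
move=> oU Up k; apply: Ck_flatten => //; apply: Ck_inversion => //.
  by move=> x Ux; rewrite subr_eq0; apply: contra_notN Up => /eqP <-.
by apply: CkD => //; [exact: Ck_id|exact: Ck_cst].
Qed.

Lemma smooth_unchart (V : set rV) : open V -> (forall w, V w -> unflatten w != 0) ->
  smooth V unchart.
Proof.
move=> oV V0 k; apply: CkD => //; first exact: Ck_cst.
by apply: Ck_inversion => //; apply: Ck_unflatten => //; exact: Ck_id.
Qed.

Definition chart_domain : set rV := [set x | 0 < wd (x - pole) (x - pole)].
Definition chart_codomain : set rV := [set w | 0 < wd (unflatten w) (unflatten w)].

Lemma chart_domainE x : chart_domain x <-> x != pole.
Proof.
split; last by move=> xp; rewrite /chart_domain/= wdot_gt0// subr_eq0.
by move=> + ; apply: contraTneq => ->; rewrite subrr -(scale0r pole) wdotZl mul0r ltxx.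
Qed.

Lemma chart_codomainE w : chart_codomain w <-> unflatten w != 0.
Proof.
split; last by move=> xp; rewrite /chart_codomain/= wdot_gt0.
by move=> + ; apply: contraTneq => ->; rewrite -(scale0r pole) wdotZl mul0r ltxx.
Qed.

Lemma open_wdot_gt0 (f : rV -> rV) : Ck 0 setT f ->
  open [set x | 0 < wd (f x) (f x)].
Proof.
move=> kf.
apply: (@open_comp _ _ (fun x => wd (f x) (f x)) [set r : R | 0 < r]); last exact: open_gt.
have kd : Ck 0 setT (fun x => wd (f x) (f x)).
  by apply: Ck_dot; [exact: openT|apply: Ck_rescale => //; exact: openT|].
by move=> x _; exact: kd.
Qed.

Lemma diffeomorphism_chart :
  diffeomorphism chart_domain chart_codomain chart unchart.
Proof.
have oU : open chart_domain.
  by apply: open_wdot_gt0; apply: CkD; [exact: openT|exact/Ck_id/openT|exact: Ck_cst].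
have oV : open chart_codomain.
  by apply: open_wdot_gt0; apply: Ck_unflatten; [exact: openT|exact/Ck_id/openT].
split => //.
- by apply: smooth_chart => //; rewrite chart_domainE eqxx.
- by apply: smooth_unchart => // w /chart_codomainE.
split.
  move=> x /chart_domainE xp; split; last exact: chartK.
  exact/chart_codomainE/unflatten_chart.
move=> w /chart_codomainE w0; split; last exact: unchartK.
exact/chart_domainE/unchart_pole.
Qed.

Lemma boundary_chart_cap p : height p = 0 -> p != pole -> boundary_chart cap p.
Proof.
move=> hp pp; exists chart_domain, chart_codomain, chart, unchart, 0, ord_max.
split => //; [exact: diffeomorphism_chart|exact/chart_domainE| |].
- by rewrite chart_max hp mul0r.
- by move=> x /chart_domainE; exact: cap_chart.
Qed.

(** The same chart restricted to the open half space, which does not contain the pole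
and is mapped onto itself. *)
Lemma interior_chart_cap p : 0 < height p -> interior_chart cap p.
Proof.
move=> hp; pose U : set rV := [set x | 0 < height x].
have oU : open U.
  apply: (@open_comp _ _ height [set r : R | 0 < r]); last exact: open_gt.
  by move=> x _; exact: height_continuous.
have Up x : U x -> x != pole.
  by move=> + ; apply: contraTneq => ->; rewrite /U/= heightE pole_max ltxx.
have U0 w : U w -> unflatten w != 0.
  by move=> + ; apply: contraTneq => w0; rewrite /U/= heightE -unflatten_max w0 mxE ltxx.
exists U, U, chart, unchart, 0; split => //.
  split => //.
  - by apply: smooth_chart => // /Up; rewrite eqxx.
  - exact: smooth_unchart.
  split=> [x Ux|w Uw].
    split; last exact/chartK/Up.
    rewrite /U/= heightE chart_max divr_gt0//.
    by apply: wdot_gt0 => //; rewrite subr_eq0 Up.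
  split; last exact/unchartK/U0.
  rewrite /U/= heightE /unchart [X in 0 < X]mxE pole_max add0r.
  rewrite [X in 0 < X]mxE unflatten_max.
  by rewrite mulr_gt0 ?invr_gt0 ?wdot_gt0 ?U0// -heightE.
move=> x Ux; split => [/(cap_chart (Up _ Ux))[]//|c0].
apply/(cap_chart (Up _ Ux)); split => //.
by rewrite chart_max divr_ge0 ?wdot_ge0// ltW.
Qed.

(** The image under the inverse chart of a closed half of a hyperplane, which is
convex. *)
Lemma connected_punctured_cap : connected (cap `&` [set x | x != pole]).
Proof.
pose F : set rV := [set w | w 0 0 = 0 /\ 0 <= w 0 ord_max].
have F0 w : F w -> unflatten w != 0.
  move=> [w00 wm]; apply/eqP => w0; have := unflatten_max w; rewrite w0 mxE => wm0.
  (* a vanishing vertical coordinate would force the first one to be - 1 / (2 q) *)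
  have /eqP := unflatten_0 w.
  rewrite w0 mxE w00 -wm0 mulr0 addr0 sub0r mulrN1 eq_sym oppr_eq0.
  by rewrite invr_eq0 mulf_eq0 (negbTE q0) orbF pnatr_eq0.
have -> : cap `&` [set x | x != pole] = unchart @` F.
  apply/seteqP; split => [x [Sx xp]|_ [w Fw <-]].
    by exists (chart x); [exact/cap_chart|exact: chartK].
  split; last by exact/unchart_pole/F0.
  by apply/cap_chart; [exact/unchart_pole/F0|rewrite unchartK ?F0].
apply: connected_continuous_connected.
  apply: (@connected_starshaped _ _ F 0); first by rewrite /F/= !mxE.
  move=> x t [x0 xm] /andP[t0 _]; rewrite /F/= !mxE !add0r subr0 subr0 x0 mulr0.
  by rewrite mulr_ge0.
apply: continuous_in_subspaceT => w; rewrite inE => Fw.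
have [_ _ _ sm _] := diffeomorphism_chart.
by apply: (sm 0%N); exact/chart_codomainE/F0.
Qed.

End Charts.

Section CapHypersurface.
Context {R : realType} {m : nat}.
Local Notation n := m.+2.
Local Notation rV := 'rV[R]_n.
Implicit Types (x y z w p : rV).
Context (e z0 rho : R).
Hypotheses (e0 : 0 < e) (z00 : 0 < z0) (rho0 : 0 < rho).
Hypothesis rho1 : rho ^+ 2 + e * z0 ^+ 2 = 1.
Local Notation cap := (@ellipsoid_cap R m e z0).
Local Notation rim := (@ellipsoid_rim R m e z0).

Lemma pole_opp_neq : (pole (- rho) : rV) != pole rho.
Proof.
apply/eqP => /(congr1 (fun x : rV => x 0 0)); rewrite !mxE/= !mulr1 => /eqP.
by rewrite lt_eqF // (lt_trans _ rho0)// oppr_lt0.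
Qed.

Lemma smooth_hypersurface_cap : smooth_hypersurface cap rim.
Proof.
split.
- by move=> x [hx Qx]; split => //; rewrite hx.
- move=> p [[hp Qp] nrim]; apply: (@interior_chart_cap _ _ _ _ rho e0 rho1 rho) => //.
    by rewrite gt_eqF.
  rewrite lt_neqAle hp andbT eq_sym; apply/eqP => hp0; exact: nrim.
- move=> p [hp Qp]; have [pp|pp] := eqVneq p (pole rho).
    apply: (@boundary_chart_cap _ _ _ _ rho e0 rho1 (- rho)) => //.
    + by rewrite oppr_eq0 gt_eqF.
    + exact: sqrrN.
    + by rewrite pp eq_sym pole_opp_neq.
  by apply: (@boundary_chart_cap _ _ _ _ rho e0 rho1 rho) => //; rewrite gt_eqF.
Qed.

(** The highest point, which belongs to both punctured caps. *)
Definition summit : rV := center z0 + Num.sqrt e^-1 *: En.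

Lemma cap_summit : cap summit /\ 0 < height summit.
Proof.
have hz : 0 < height summit.
  rewrite /summit heightD heightZ height_center heightE En_max mulr1.
  by rewrite ltr_pwDl// sqrtr_ge0.
split => //; split; first exact: ltW.
rewrite /quadric /summit addrC addKr wdotZl wdotZr wdot_En En_max mulr1 mulrA -expr2.
by rewrite sqr_sqrtr ?invr_ge0 ?ltW// mulVf// gt_eqF.
Qed.

Lemma connected_cap : connected cap.
Proof.
have summit_pole q : summit != pole q.
  apply/eqP => tp; have [_] := cap_summit.
  by rewrite tp heightE pole_max ltxx.
have -> : cap =
    (cap `&` [set x | x != pole rho]) `|` (cap `&` [set x | x != pole (- rho)]).
  apply/seteqP; split => [x Sx|x [[]|[]]//].
  have [xp|xp] := eqVneq x (pole rho); [right|left]; split => //.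
  by rewrite /= xp eq_sym pole_opp_neq.
apply: connectedU.
- by exists summit; have [? _] := cap_summit; split; split => //; exact: summit_pole.
- by apply: (@connected_punctured_cap _ _ _ _ rho e0 rho1 rho) => //; rewrite gt_eqF.
- apply: (@connected_punctured_cap _ _ _ _ rho e0 rho1 (- rho)).
  + by rewrite oppr_eq0 gt_eqF.
  + exact: sqrrN.
Qed.

Lemma cap_diff_rim x : (cap `\` rim) x -> 0 < height x.
Proof.
move=> [[hx Qx] nrim]; rewrite lt_neqAle hx andbT eq_sym.
by apply/eqP => hx0; exact: nrim.
Qed.

Lemma rim_neq0 : rim !=set0.
Proof.
exists (pole rho); split; first by rewrite heightE pole_max.
rewrite -[pole rho]addr0 (quad_pole rho1)// -(scale0r (pole rho)) wdotZl !mxE/=.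
by ring.
Qed.

End CapHypersurface.

(** * Normal field and convexity *)

Section Normal.
Context {R : realType} {m : nat}.
Local Notation n := m.+2.
Local Notation rV := 'rV[R]_n.
Implicit Types (x y z w p v : rV).
Context (e z0 : R).
Hypothesis e0 : 0 < e.
Local Notation quad := (quadric e z0).
Local Notation cen := (center z0).
Local Notation wd := (wdot e).
Local Notation cap := (@ellipsoid_cap R m e z0).
Local Notation W := (rescale (weight e)).

(** Half the gradient of the quadric. *)
Definition half_grad x : rV := W (x - cen).
Definition inv_grad_norm x : R := (Num.sqrt (dot (half_grad x) (half_grad x)))^-1.
Definition ellipsoid_normal x : rV := inv_grad_norm x *: half_grad x.

Lemma half_grad_neq0 x : quad x = 1 -> half_grad x != 0.
Proof.
move=> Qx; apply/eqP => gx; have : quad x = dot (half_grad x) (x - cen) by [].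
by rewrite gx Qx -(scale0r (0 : rV)) dotZl mul0r => /eqP; rewrite oner_eq0.
Qed.

Lemma inv_grad_norm_gt0 x : half_grad x != 0 -> 0 < inv_grad_norm x.
Proof. by move=> gx; rewrite invr_gt0 sqrtr_gt0 dot_gt0. Qed.

Lemma dot_ellipsoid_normal x : half_grad x != 0 ->
  dot (ellipsoid_normal x) (ellipsoid_normal x) = 1.
Proof.
move=> gx; rewrite dotZl dotZr mulrA -expr2 exprVn sqr_sqrtr ?dot_ge0//.
by rewrite mulVf// gt_eqF// dot_gt0.
Qed.

Lemma quadricD x y : quad (x + y) = quad x + 2 * wd (x - cen) y + wd y y.
Proof.
rewrite /quadric addrAC; move: (x - cen) => a.
by rewrite wdotDl !wdotDr (wdotC e y a); ring.
Qed.

Lemma derive_quadric p v : 'D_v quad p = 2 * wd (p - cen) v.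
Proof.
apply: (@derive_quadratic _ _ _ _ _ _ _ (wd v v)) => h.
by rewrite addrC quadricD wdotZl !wdotZr /GRing.scale/=; ring.
Qed.

Lemma derive_half_grad p v : 'D_v half_grad p = W v.
Proof.
apply: (@derive_quadratic _ _ _ _ _ _ _ 0) => h.
rewrite /half_grad scaler0 addr0 -[h *: v + p - _]addrA.
rewrite (rescaleD _ (h *: v)) rescaleZ.
exact: addrC.
Qed.

Lemma Ck_half_grad k (U : set rV) : open U -> Ck k U half_grad.
Proof.
move=> oU; apply: Ck_rescale => //; apply: CkD => //; [exact: Ck_id|exact: Ck_cst].
Qed.

Definition noncritical : set rV := [set x | 0 < dot (half_grad x) (half_grad x)].

Lemma noncriticalP x : half_grad x != 0 -> noncritical x.
Proof. exact: dot_gt0. Qed.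

Lemma open_noncritical : open noncritical.
Proof.
apply: (@open_comp _ _ (fun x => dot (half_grad x) (half_grad x))
  [set r : R | 0 < r]); last exact: open_gt.
have kd : Ck 0 setT (fun x => dot (half_grad x) (half_grad x)).
  by apply: Ck_dot; [exact: openT|exact/Ck_half_grad/openT|exact/Ck_half_grad/openT].
by move=> x _; exact: kd.
Qed.

Lemma Ck_inv_grad_norm k : Ck k noncritical inv_grad_norm.
Proof.
apply: Ck_sqrtV; [exact: open_noncritical|by []|].
have oN := open_noncritical; have kg := Ck_half_grad k oN.
exact: Ck_dot.
Qed.

Lemma smooth_ellipsoid_normal : smooth noncritical ellipsoid_normal.
Proof.
move=> k; have oN := open_noncritical.
by apply: CkZ => //; [exact: Ck_inv_grad_norm|exact: Ck_half_grad].
Qed.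

Lemma smooth_on_ellipsoid_normal : smooth_on cap ellipsoid_normal.
Proof.
move=> p [_ Qp]; exists ellipsoid_normal, noncritical; split => //.
- exact: open_noncritical.
- exact/noncriticalP/half_grad_neq0.
- exact: smooth_ellipsoid_normal.
Qed.

Lemma tangent_half_grad p v : cap p -> tangent cap p v -> dot (half_grad p) v = 0.
Proof.
move=> [_ Qp] /(@derive_tangent _ _ _ _ _ _ quad) => H.
have : 'D_v quad p = 0.
  apply: H; last first.
    by rewrite Qp; apply: (@nearW _ (nbhs p)) => x [].
  by have [/(_ p I)] := @Ck_quadric R m e z0 1%N setT openT.
by rewrite derive_quadric => /eqP; rewrite mulf_eq0 pnatr_eq0/= => /eqP.
Qed.

Lemma unit_normal_field_cap : unit_normal_field cap ellipsoid_normal.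
Proof.
move=> p Sp; have gp := half_grad_neq0 Sp.2; split.
  by rewrite /enorm dot_ellipsoid_normal// sqrtr1.
by move=> v /(tangent_half_grad Sp) gv; rewrite dotZl gv mulr0.
Qed.

Lemma ellipsoid_normal_outer p t : quad p = 1 -> 0 < t ->
  1 < quad (p + t *: ellipsoid_normal p).
Proof.
move=> Qp t0; have gp := half_grad_neq0 Qp.
have gn : 0 < wd (p - cen) (ellipsoid_normal p).
  by rewrite /wdot -/(half_grad p) dotZr mulr_gt0 ?inv_grad_norm_gt0// dot_gt0.
rewrite quadricD Qp (wdotZl _ t) !(wdotZr _ t).
have : 0 <= t * (t * wd (ellipsoid_normal p) (ellipsoid_normal p))
  by rewrite mulr_ge0 ?(ltW t0)// mulr_ge0 ?(ltW t0)// wdot_ge0.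
by have := mulr_gt0 t0 gn; lra.
Qed.

(** An extension N of the normal agrees with the normalized gradient on the cap, so
both have the same derivative along a tangent vector v. For u times the half
gradient, with u > 0, the derivative paired with v is u times the weighted square
of v, because the term with D_v u is killed by the orthogonality of v to the
gradient. *)
Lemma positive_definite_cap : positive_definite_sff cap ellipsoid_normal.
Proof.
move=> p N Sp [U [oU Up sN NE]] v vt v0; have gp := half_grad_neq0 Sp.2.
have dN : differentiable N p by have [/(_ p Up)] := sN 1%N.
have dnu : differentiable ellipsoid_normal p.
  by have [/(_ p (noncriticalP gp))] := smooth_ellipsoid_normal 1%N.
have dsl : differentiable inv_grad_norm p.
  by have [/(_ p (noncriticalP gp))] := Ck_inv_grad_norm 1%N.
have dgr : differentiable half_grad p by have [/(_ p I)] := Ck_half_grad 1%N openT.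
have ddot (F : rV -> rV) : differentiable F p ->
    differentiable (fun x => dot (F x) v) p.
  move=> dF; rewrite /dot.
  rewrite -(fct_sumE _ _ (fun i x => F x 0 i * v 0 i)).
  apply: differentiable_sum => i; apply: differentiableM => //.
  apply: (@differentiable_comp _ _ _ _ F (fun y : rV => y 0 i)) => //.
  exact: differentiable_coord.
rewrite /second_fundamental_form -derive_dot//.
have : 'D_v ((fun x => dot (N x) v) - (fun x => dot (ellipsoid_normal x) v)) p = 0.
  apply: derive_tangent vt; first by apply: differentiableB; exact: ddot.
  apply: filterS (open_nbhs_nbhs (conj oU Up)) => x Ux Sx.
  by rewrite !fctE /= !NE// !subrr.
rewrite deriveB; [|exact/diff_derivable/ddot..].
move=> /subr0_eq ->.
have -> : (fun x => dot (ellipsoid_normal x) v) =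
    inv_grad_norm * (fun x => dot (half_grad x) v).
  by apply/funext => x; rewrite fctE dotZl.
rewrite deriveM; [|exact: diff_derivable|exact/diff_derivable/ddot].
rewrite tangent_half_grad// scale0r addr0 derive_dot// derive_half_grad.
by rewrite mulr_gt0 ?inv_grad_norm_gt0// wdot_gt0.
Qed.

End Normal.

(** * The capillary ellipsoid and its support function *)

Section CapillaryEllipsoid.
Context {R : realType} {m : nat}.
Local Notation n := m.+2.
Local Notation rV := 'rV[R]_n.
Implicit Types (x y z w p v nu zeta : rV).
Context (e z0 rho theta : R).
Local Notation c := (- cos theta).
Local Notation s := (sin theta).
Hypotheses (e0 : 0 < e) (z00 : 0 < z0) (rho0 : 0 < rho) (c0 : 0 < c) (s0 : 0 < s).
Hypothesis rho1 : rho ^+ 2 + e * z0 ^+ 2 = 1.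
Hypothesis angle : e * z0 * s = c * rho.
Local Notation quad := (quadric e z0).
Local Notation cen := (center z0).
Local Notation wd := (wdot e).
Local Notation cap := (@ellipsoid_cap R m e z0).
Local Notation rim := (@ellipsoid_rim R m e z0).
Local Notation solid := (@ellipsoid_solid R m e z0).
Local Notation W := (rescale (weight e)).
Local Notation W' := (rescale (weight e^-1)).

Lemma cs1 : c ^+ 2 + s ^+ 2 = 1.
Proof. by rewrite sqrrN cos2Dsin2. Qed.

(** The square of the capillary condition, with s eliminated. The right-hand factor is
the squared norm of the half gradient along the boundary sphere. *)
Lemma angle_identity : (e * z0) ^+ 2 = c ^+ 2 * (rho ^+ 2 + (e * z0) ^+ 2).
Proof.
have : (e * z0) ^+ 2 * s ^+ 2 = c ^+ 2 * rho ^+ 2 by rewrite -!exprMn angle.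
have -> : s ^+ 2 = 1 - c ^+ 2 by rewrite -cs1; ring.
by lra.
Qed.

Lemma dot_half_grad x : dot (half_grad e z0 x) (half_grad e z0 x) =
  quad x - (1 - e) * e * (height x - z0) ^+ 2.
Proof.
have := dot_wdot e (x - cen) (half_grad e z0 x).
have -> : dot (x - cen) (half_grad e z0 x) = quad x by rewrite dotC.
have -> : wd (x - cen) (half_grad e z0 x) =
    dot (half_grad e z0 x) (half_grad e z0 x) by [].
have -> : (x - cen) 0 ord_max = height x - z0.
  by rewrite -heightE -scaleN1r heightD heightZ height_center mulN1r.
rewrite [(half_grad _ _ _) 0 ord_max]mxE /weight eqxx.
have -> : (x - cen) 0 ord_max = height x - z0.
  by rewrite -heightE -scaleN1r heightD heightZ height_center mulN1r.
by move=> ->; ring.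
Qed.

Lemma cap_angle_rim p : rim p -> dot (ellipsoid_normal e z0 p) En = cos theta.
Proof.
move=> [hp Qp]; rewrite dotZl dot_En mxE /weight eqxx -heightE.
rewrite -scaleN1r heightD heightZ height_center hp add0r mulN1r /inv_grad_norm.
have -> : dot (half_grad e z0 p) (half_grad e z0 p) = (e * z0 / c) ^+ 2.
  have cn : c ^+ 2 != 0 by rewrite gt_eqF// exprn_gt0.
  rewrite dot_half_grad Qp hp expr_div_n angle_identity [RHS]mulrAC mulfV// mul1r.
  by move: rho1; lra.
have ez0 : 0 < e * z0 by rewrite mulr_gt0.
rewrite sqrtr_sqr ger0_norm; last by rewrite divr_ge0 ?ltW.
rewrite invf_div; field; by rewrite !gt_eqF.
Qed.

Definition capillary_ellipsoid : capillary_hypersurface n theta.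
Proof.
apply: (@CapillaryHypersurface R n theta cap rim (ellipsoid_normal e z0)).
- exact: smooth_hypersurface_cap rho1.
- exact: compact_cap.
- exact: connected_cap rho1.
- by move=> x /cap_diff_rim.
- by move=> p [].
- exact: rim_neq0 rho1.
- exact: smooth_on_ellipsoid_normal.
- exact: unit_normal_field_cap.
- move=> p [[_ Qp] _]; near=> t; rewrite enclosed_region_cap//.
  have t0 : 0 < t by [].
  by move=> [_]; rewrite leNgt ellipsoid_normal_outer.
- exact: cap_angle_rim.
Unshelve. all: by end_near. Defined.

Local Notation S := capillary_ellipsoid.

Lemma strictly_convex_ellipsoid : strictly_convex S.
Proof.
split; last exact: positive_definite_cap.
by rewrite /= enclosed_region_cap//; exact: convex_body_solid.
Qed.

(** Square of the support function of the centred full ellipsoid, at a unit vector of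
height t. *)
Definition sqr_support (t : R) : R := 1 + (e^-1 - 1) * t ^+ 2.

(** The point of the full ellipsoid with outer unit normal nu. *)
Definition gauss_preimage nu : rV :=
  cen + (Num.sqrt (sqr_support (height nu)))^-1 *: W' nu.

Lemma sqr_supportE nu : dot nu nu = 1 -> dot (W' nu) nu = sqr_support (height nu).
Proof.
have := dot_wdot e^-1 nu nu; rewrite /wdot => + nu1.
by rewrite nu1 /sqr_support heightE; lra.
Qed.

Lemma rescaleK x : W (W' x) = x.
Proof.
apply/rowP => i; rewrite !mxE /weight; case: ifP => _; last by rewrite !mul1r.
by rewrite mulVKf// gt_eqF.
Qed.

Lemma rescaleVK x : W' (W x) = x.
Proof.
apply/rowP => i; rewrite !mxE /weight; case: ifP => _; last by rewrite !mul1r.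
by rewrite mulKf// gt_eqF.
Qed.

Lemma sqr_support_gt0 nu : dot nu nu = 1 -> 0 < sqr_support (height nu).
Proof.
move=> nu1; rewrite -sqr_supportE//; apply: dot_rescale_sq_gt0.
  by apply: weight_gt0; rewrite invr_gt0.
apply/eqP => nu0; move: nu1; rewrite nu0 -(scale0r (0 : rV)) dotZl mul0r => /eqP.
by rewrite eq_sym oner_eq0.
Qed.

(** With k = (sqr_support t)^(-1/2) this says that the points of the full ellipsoid
with normal of height t in [- c, 0] are not below the hyperplane. Multiplied out
it is t^2 (rho^2 + (e z0)^2) <= (e z0)^2, which is an equality at t^2 = c^2 by
angle_identity. *)
Lemma sqr_le_sqr_support (t : R) : t ^+ 2 <= c ^+ 2 ->
  t ^+ 2 <= (e * z0) ^+ 2 * sqr_support t.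
Proof.
move=> tc; have q0 : 0 <= rho ^+ 2 + (e * z0) ^+ 2 by rewrite addr_ge0// sqr_ge0.
have := ler_wpM2r q0 tc; rewrite -angle_identity.
have -> : (e * z0) ^+ 2 * sqr_support t =
    (e * z0) ^+ 2 + (e * z0 ^+ 2 - (e * z0) ^+ 2) * t ^+ 2.
  by rewrite /sqr_support; field; rewrite gt_eqF.
have -> : e * z0 ^+ 2 = 1 - rho ^+ 2 by move: rho1; lra.
by lra.
Qed.

Lemma gauss_preimage_height_ge0 (k t : R) :
  0 < k -> k ^+ 2 * sqr_support t = 1 -> - c <= t -> 0 <= z0 + k * (e^-1 * t).
Proof.
move=> k0 kP tc; have eV : 0 < e^-1 by rewrite invr_gt0.
have [t0|t0] := leP 0 t.
  by rewrite addr_ge0 ?(ltW z00)// mulr_ge0 ?(ltW k0)// mulr_ge0// ltW.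
have t2 : t ^+ 2 <= c ^+ 2.
  by rewrite -(sqrrN t) ler_pXn2r ?nnegrE ?oppr_ge0 ?(ltW t0) ?(ltW c0)//; move: tc; lra.
suff : k * (e^-1 * - t) <= z0 by rewrite !mulrN; lra.
have L0 : 0 <= k * (e^-1 * - t).
  by rewrite mulr_ge0 ?(ltW k0)// mulr_ge0 ?(ltW eV)// oppr_ge0 ltW.
rewrite -(@ler_pXn2r _ 2%N)// ?nnegrE ?(ltW z00)//.
have a0 : 0 <= (k * e^-1) ^+ 2 by exact: sqr_ge0.
have := ler_wpM2l a0 (sqr_le_sqr_support t2).
have -> : (k * e^-1) ^+ 2 * ((e * z0) ^+ 2 * sqr_support t) =
    (k ^+ 2 * sqr_support t) * z0 ^+ 2.
  by field; rewrite gt_eqF.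
rewrite kP mul1r; apply: le_trans.
by rewrite (_ : (k * (e^-1 * - t)) ^+ 2 = (k * e^-1) ^+ 2 * t ^+ 2)//; ring.
Qed.

Lemma gauss_preimageP nu : dot nu nu = 1 -> - c <= height nu ->
  cap (gauss_preimage nu) /\ ellipsoid_normal e z0 (gauss_preimage nu) = nu.
Proof.
move=> nu1 hnu; have P0 := sqr_support_gt0 nu1.
set k := (Num.sqrt (sqr_support (height nu)))^-1.
have k0 : 0 < k by rewrite invr_gt0 sqrtr_gt0.
have k2 : k ^+ 2 * sqr_support (height nu) = 1.
  by rewrite exprVn sqr_sqrtr ?ltW// mulVf// gt_eqF.
have gX : half_grad e z0 (gauss_preimage nu) = k *: nu.
  by rewrite /half_grad /gauss_preimage addrC addKr rescaleZ rescaleK.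
split.
  split; last first.
    rewrite /quadric /gauss_preimage addrC addKr wdotZl wdotZr /wdot rescaleK.
    by rewrite dotC sqr_supportE// mulrA -expr2.
  rewrite /gauss_preimage -/k /= heightD height_center heightZ.
  have -> : height (W' nu) = e^-1 * height nu by rewrite !heightE mxE /weight eqxx.
  exact: gauss_preimage_height_ge0.
rewrite /ellipsoid_normal /inv_grad_norm gX dotZl dotZr nu1 mulr1 -expr2.
rewrite sqrtr_sqr ger0_norm ?ltW//.
by rewrite scalerA mulVf ?scale1r// gt_eqF.
Qed.

Lemma gauss_preimage_unique x nu : cap x -> ellipsoid_normal e z0 x = nu ->
  x = gauss_preimage nu.
Proof.
move=> [hx Qx] nux; have gx := half_grad_neq0 Qx.
have nu1 : dot nu nu = 1 by rewrite -nux dot_ellipsoid_normal.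
have P0 := sqr_support_gt0 nu1.
have sl0 := inv_grad_norm_gt0 gx.
have xE : x - cen = (inv_grad_norm e z0 x)^-1 *: W' nu.
  rewrite -nux /ellipsoid_normal rescaleZ scalerA mulVf ?gt_eqF// scale1r.
  by rewrite /half_grad rescaleVK.
have k2 : (inv_grad_norm e z0 x)^-1 ^+ 2 * sqr_support (height nu) = 1.
  move: Qx; rewrite /quadric xE wdotZl wdotZr /wdot rescaleK.
  by rewrite dotC sqr_supportE// mulrA -expr2.
suff -> : gauss_preimage nu = cen + (x - cen) by rewrite addrC subrK.
rewrite xE /gauss_preimage; congr (_ + _ *: _).
apply/eqP; rewrite -(@eqrXn2 _ 2%N)// ?invr_ge0 ?sqrtr_ge0 ?(ltW sl0)//.
rewrite [X in X == _]exprVn sqr_sqrtr ?ltW//; apply/eqP.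
by apply: (mulIf (lt0r_neq0 P0)); rewrite k2 mulVf// gt_eqF.
Qed.

(** The support function of the full ellipsoid centred at z0 E_n: up to the translation
by cos theta E_n, the capillary Gauss map is the restriction of the Gauss map of
the full ellipsoid. *)
Lemma capillary_support_ellipsoid zeta : @model_cap R n theta zeta ->
  capillary_support S zeta =
  Num.sqrt (sqr_support (height zeta - c)) + z0 * (height zeta - c).
Proof.
move=> [hz zeta1]; rewrite /capillary_support /capillary_gauss_map/=.
set nu := zeta + cos theta *: En.
have hnu : height nu = height zeta - c.
  by rewrite /nu heightD heightZ heightE [X in _ * X]heightE En_max -heightE; ring.
have nu1 : dot nu nu = 1.
  move: zeta1; rewrite /enorm => /(congr1 (fun r => r ^+ 2)).
  by rewrite sqr_sqrtr ?dot_ge0// expr1n.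
have hc : - c <= height nu by rewrite hnu; lra.
set P := [set x | _].
have PE x : P x <-> x = gauss_preimage nu.
  have [cX nX] := gauss_preimageP nu1 hc.
  rewrite /P/=; split=> [[Sx nux]|->].
    by apply: gauss_preimage_unique => //; rewrite /nu -nux subrK.
  by split => //; rewrite nX /nu addrK.
have -> : get P = gauss_preimage nu.
  by apply/PE; apply: getPex; exists (gauss_preimage nu); apply/PE.
have P0 := sqr_support_gt0 nu1.
rewrite hnu in P0; rewrite /gauss_preimage dotDl (dotZl _ (W' nu)) sqr_supportE// hnu.
rewrite addrC; congr (_ + _).
  by rewrite -{2}(sqr_sqrtr (ltW P0)) expr2 mulKf// gt_eqF// sqrtr_gt0.
by rewrite /center dotZl dotC -/(height nu) hnu.
Qed.

Lemma height_reflection x : height (horizontal_reflection x) = height x.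
Proof. by rewrite !heightE mxE eqxx. Qed.

Lemma model_cap_reflection zeta :
  model_cap (theta := theta) zeta ->
  model_cap (theta := theta) (horizontal_reflection zeta).
Proof.
move=> [hz z1]; split; first by rewrite height_reflection.
rewrite -z1 /enorm; congr Num.sqrt; apply: eq_bigr => i _.
rewrite !mxE; case: eqP => _; rewrite ?mulr0 ?addr0//; last by rewrite mulrNN.
Qed.

(** The support function only depends on the height. *)
Lemma capillary_even_ellipsoid : capillary_even S.
Proof.
move=> zeta zc; rewrite !capillary_support_ellipsoid ?height_reflection//.
exact: model_cap_reflection.
Qed.

(** With t = height zeta - c in [- c, 0] the support function is
sqrt (1 - t^2 + t^2 / e) - z0 |t|. It is positive because z0^2 < 1 / e and
t^2 < 1; the upper bound does not degenerate as e tends to 0 because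
rho^2 / e = (1 / e) - z0^2 stays below z0 / c, by the capillary condition. *)
Lemma capillary_support_bounds zeta :
  model_cap (theta := theta) zeta -> height zeta <= c ->
  0 < capillary_support S zeta <= 1.
Proof.
move=> zc hz; rewrite capillary_support_ellipsoid//.
set t := height zeta - c.
have tc : - c <= t by case: zc => + _; rewrite /t; lra.
have t0 : t <= 0 by rewrite /t; lra.
have eV : 0 < e^-1 by rewrite invr_gt0.
have ez : e * e^-1 = 1 by rewrite mulfV// gt_eqF.
have r1 : rho ^+ 2 <= 1 by rewrite -rho1 lerDl mulr_ge0 ?sqr_ge0// ltW.
have z2 : z0 ^+ 2 = e^-1 * (1 - rho ^+ 2).
  have -> : 1 - rho ^+ 2 = e * z0 ^+ 2 by move: rho1; lra.
  by rewrite mulKf// gt_eqF.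
have c1 : c ^+ 2 < 1 by rewrite -cs1 ltrDl exprn_gt0.
have t2 : t ^+ 2 <= c ^+ 2.
  by rewrite -(sqrrN t) ler_pXn2r ?nnegrE ?oppr_ge0 ?(ltW c0)//; move: tc; lra.
have PE : sqr_support t = 1 - t ^+ 2 + e^-1 * t ^+ 2 by rewrite /sqr_support; ring.
have P1 : (z0 * - t) ^+ 2 < sqr_support t.
  rewrite exprMn sqrrN z2 PE.
  have : 0 <= e^-1 * rho ^+ 2 * t ^+ 2.
    by rewrite mulr_ge0 ?sqr_ge0// mulr_ge0 ?sqr_ge0// ltW.
  by lra.
have zt : 0 <= z0 * - t by rewrite mulr_ge0 ?oppr_ge0// ltW.
apply/andP; split.
  suff : z0 * - t < Num.sqrt (sqr_support t) by rewrite mulrN; lra.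
  by rewrite -(ger0_norm zt) -sqrtr_sqr ltr_sqrt// (le_lt_trans (sqr_ge0 _) P1).
suff : Num.sqrt (sqr_support t) <= 1 + z0 * - t by rewrite mulrN; lra.
have w0 : 0 <= 1 + z0 * - t by rewrite addr_ge0.
rewrite -(ger0_norm w0) -sqrtr_sqr; apply: ler_wsqrtr.
have -> : (1 + z0 * - t) ^+ 2 = 1 + 2 * (z0 * - t) + z0 ^+ 2 * t ^+ 2 by ring.
rewrite PE z2.
suff : e^-1 * rho ^+ 2 * t ^+ 2 <= 2 * (z0 * - t) by have := sqr_ge0 t; lra.
have s1 : s <= 1 by exact: sin_le1.
have rho_le1 : rho <= 1.
  by rewrite -(@ler_pXn2r _ 2%N)// ?nnegrE ?(ltW rho0)// expr1n.
(* |t| <= c, and c rho = e z0 s by the capillary condition *)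
have key : e^-1 * rho ^+ 2 * - t <= z0.
  have : e^-1 * rho ^+ 2 * - t <= e^-1 * rho ^+ 2 * c.
    apply: ler_wpM2l; first by rewrite mulr_ge0 ?sqr_ge0 ?(ltW eV).
    by move: tc; lra.
  have -> : e^-1 * rho ^+ 2 * c = rho * s * z0.
    have -> : e^-1 * rho ^+ 2 * c = e^-1 * rho * (c * rho) by ring.
    by rewrite -angle; field; rewrite gt_eqF.
  move/le_trans; apply; rewrite ler_piMl ?(ltW z00)//.
  by rewrite mulr_ile1 ?(ltW rho0) ?(ltW s0)//.
have nt : 0 <= - t by rewrite oppr_ge0.
have := ler_wpM2r nt key.
by lra.
Qed.

End CapillaryEllipsoid.

(** * Volumes of the enclosed region and of the polar body *)

Section Volumes.
Context {R : realType} {m : nat}.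
Local Notation n := m.+2.
Local Notation rV := 'rV[R]_n.
Implicit Types (x : rV).
Context (e z0 rho theta : R).
Local Notation c := (- cos theta).
Local Notation s := (sin theta).
Hypotheses (e0 : 0 < e) (z00 : 0 < z0) (rho0 : 0 < rho) (c0 : 0 < c) (s0 : 0 < s).
Hypothesis rho1 : rho ^+ 2 + e * z0 ^+ 2 = 1.
Hypothesis angle : e * z0 * s = c * rho.
Local Notation S :=
  (@capillary_ellipsoid R m e z0 rho theta e0 z00 rho0 c0 rho1 angle).

(** The box is centred on the axis, and its vertical side starts at the centre and
has length half the vertical semi-axis. *)
Lemma vol_solid_ge :
  ((((m.+1%:R)^-1) ^+ m.+1 * (Num.sqrt e^-1 / 2))%:E <= vol (enclosed_region S))%E.
Proof.
rewrite /= enclosed_region_cap//.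
(* m.+1 horizontal coordinates bounded by k contribute at most 1 / 4 to the
   quadric, and so does the vertical one *)
set b := Num.sqrt e^-1; pose k : R := (2 * m.+1%:R)^-1.
have m0 : 0 < m.+1%:R :> R by rewrite ltr0n.
have m1 : 1 <= m.+1%:R :> R by rewrite ler1n.
have b0 : 0 <= b by exact: sqrtr_ge0.
have b2 : e * b ^+ 2 = 1 by rewrite sqr_sqrtr ?invr_ge0 ?ltW// mulfV// gt_eqF.
have k0 : 0 <= k by rewrite invr_ge0 mulr_ge0 ?ltW.
have -> : (m.+1%:R)^-1 = k - - k by rewrite /k; field; rewrite gt_eqF.
have -> : b / 2 = (z0 + b / 2) - z0 by ring.
apply: vol_vertical_box_ge; [by rewrite ge0_cp|by rewrite lerDl divr_ge0|].
move=> x xk /andP[zx xb]; split; first by rewrite /= heightE (le_trans (ltW z00)).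
have yE : height (x - center z0) = x 0 ord_max - z0.
  by rewrite -scaleN1r heightD heightZ height_center mulN1r -heightE.
rewrite /quadric /wdot.
have := dot_wdot e (x - center z0) (x - center z0); rewrite -heightE yE dot_split yE.
rewrite (eq_bigr (fun i => x 0 i ^+ 2)) => [|i im]; last first.
  rewrite !mxE (_ : (i.+1 == n) = false) ?mulr0 ?subr0//.
  by apply: contraNF im => /eqP [im]; apply/eqP/val_inj.
have : \sum_(i < n | i != ord_max) x 0 i ^+ 2 <= m.+1%:R * k ^+ 2.
  apply: sum_sqr_le => i /xk xi.
  by rewrite -(real_normK (num_real _)) ler_pXn2r ?nnegrE// ler_norml.
have : m.+1%:R * k ^+ 2 <= 4^-1.
  have -> : m.+1%:R * k ^+ 2 = (m.+1%:R)^-1 * 4^-1.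
    by rewrite /k; field; rewrite gt_eqF.
  have : (m.+1%:R)^-1 <= 1 :> R by rewrite invf_le1.
  by move: (m.+1%:R^-1) => u; lra.
have : e * (x 0 ord_max - z0) ^+ 2 <= 4^-1.
  have -> : 4^-1 = e * (b / 2) ^+ 2 by rewrite expr_div_n mulrA b2; field.
  rewrite ler_pM2l// ler_pXn2r ?nnegrE ?subr_ge0 ?divr_ge0//.
  by rewrite lerBlDl.
rewrite /wdot; lra.
Qed.

(** Sides of a box in the polar body: horizontal coordinates between polar_side and
2 polar_side, height between 0 and polar_height. They are small enough for the
two inequalities of mem_polar_body. *)
Definition polar_side : R := s ^+ 3 / (2 * n%:R).
Definition polar_height : R := c * polar_side / 2.

Lemma polar_side_gt0 : 0 < polar_side.
Proof. by rewrite divr_gt0 ?exprn_gt0 ?mulr_gt0 ?ltr0n. Qed.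

Lemma polar_height_gt0 : 0 < polar_height.
Proof. by rewrite divr_gt0 ?mulr_gt0 ?polar_side_gt0. Qed.

(** Since c < 1, the origin lies inside the sphere of the model cap, so the ray through
x meets the cap at t x for a unique t > 0, the positive root of a quadratic
equation. The bound |x| <= s^3 gives t >= 1 / s^2, hence x = t^-1 (t x) with
t^-1 <= s^2 <= model_support. The last hypothesis says that x is nearly
horizontal, so that t x has height at most c, where the support function is at
most 1. *)
Lemma mem_polar_body x : 0 <= height x -> 0 < dot x x -> dot x x <= s ^+ 6 ->
  (1 + 2 * c ^+ 2) * height x ^+ 2 <= c ^+ 2 * dot x x -> polar_body S x.
Proof.
set h := height x; set A := dot x x => h0 A0 As hA.
have cs : c ^+ 2 + s ^+ 2 = 1 := cs1 theta.
pose r := Num.sqrt (c ^+ 2 * h ^+ 2 + A * s ^+ 2).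
have D0 : 0 < c ^+ 2 * h ^+ 2 + A * s ^+ 2.
  apply: ltr_wpDl; first by rewrite mulr_ge0 ?sqr_ge0.
  by rewrite mulr_gt0 ?exprn_gt0.
have r0 : 0 < r by rewrite sqrtr_gt0.
have r2 : r ^+ 2 = c ^+ 2 * h ^+ 2 + A * s ^+ 2 by rewrite sqr_sqrtr ?ltW.
pose t := (c * h + r) / A.
have t0 : 0 < t.
  by apply: divr_gt0 => //; apply: ltr_wpDl => //; rewrite mulr_ge0// ltW.
(* t x is on the sphere of the model cap *)
have tA : t ^+ 2 * A = s ^+ 2 + 2 * c * (t * h).
  have tA : t * A = c * h + r by rewrite /t divfK// gt_eqF.
  apply: (mulIf (lt0r_neq0 A0)).
  have -> : t ^+ 2 * A * A = (t * A) ^+ 2 by ring.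
  rewrite tA sqrrD r2 mulrDl.
  have -> : 2 * c * (t * h) * A = 2 * c * h * (t * A) by ring.
  by rewrite tA; ring.
have th0 : 0 <= t * h by rewrite mulr_ge0// ltW.
have hz : height (t *: x) = t * h by rewrite heightZ.
have zc : @model_cap R n theta (t *: x).
  split; first by rewrite hz.
  rewrite /enorm dotDl !dotDr !dotZl !dotZr (dotC En x) -/(height x) -/h -/A.
  rewrite -/(height En) heightE En_max mulr1 mulrA -expr2 tA.
  have -> : s ^+ 2 + 2 * c * (t * h) + t * (cos theta * h) +
    (cos theta * (t * h) + cos theta * cos theta) = c ^+ 2 + s ^+ 2 by ring.
  by rewrite cs sqrtr1.
have thc : t * h <= c.
  rewrite leNgt; apply/negP => cu.
  have := ler_wpM2l (sqr_ge0 t) hA.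
  have -> : t ^+ 2 * (c ^+ 2 * A) = c ^+ 2 * (t ^+ 2 * A) by ring.
  rewrite tA; have -> : t ^+ 2 * ((1 + 2 * c ^+ 2) * h ^+ 2) =
    (t * h) ^+ 2 + 2 * c ^+ 2 * (t * h) ^+ 2 by ring.
  move: (t * h) th0 cu => u u0 cu.
  have u2 : c ^+ 2 < u ^+ 2 by rewrite ltr_pXn2r ?nnegrE ?(ltW c0).
  have : c ^+ 2 * (c * u) <= c ^+ 2 * (u * u).
    by rewrite ler_wpM2l ?sqr_ge0// ler_wpM2r// ltW.
  have : 0 <= c ^+ 2 * c ^+ 2 by rewrite mulr_ge0 ?sqr_ge0.
  have -> : s ^+ 2 = 1 - c ^+ 2 by rewrite -cs; ring.
  lra.
rewrite -hz in thc.
have /andP[sp s1] := capillary_support_bounds e0 z00 rho0 c0 s0 rho1 angle zc thc.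
exists t^-1, (t *: x); split => //; first by rewrite invr_ge0 ltW.
  have ls : s ^+ 2 <= model_support (theta := theta) (t *: x).
    by rewrite /model_support -/(height (t *: x)) hz -mulNr lerDl mulr_ge0// ltW.
  rewrite ler_pdivlMr// (le_trans _ ls)//.
  have tV : t^-1 <= s ^+ 2.
    have st0 : 0 <= s ^+ 2 * t by exact: mulr_ge0 (sqr_ge0 _) (ltW t0).
    rewrite -[leLHS]mul1r ler_pdivrMr// -(@ler_pXn2r _ 2%N)// ?nnegrE//.
    rewrite expr1n -(ler_pM2r A0) mul1r (le_trans As)//.
    have -> : (s ^+ 2 * t) ^+ 2 * A = s ^+ 4 * (t ^+ 2 * A) by ring.
    have -> : s ^+ 6 = s ^+ 4 * s ^+ 2 by ring.
    rewrite ler_wpM2l ?exprn_ge0 ?(ltW s0)// tA lerDl.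
    by rewrite mulr_ge0// mulr_ge0// ltW.
  apply: le_trans tV; rewrite ler_piMr// invr_ge0 ltW//.
by rewrite scalerA mulVf ?scale1r// gt_eqF.
Qed.

Lemma vol_polar_ge :
  ((polar_side ^+ m.+1 * polar_height)%:E <= vol (polar_body S))%E.
Proof.
have d0 := polar_side_gt0; have p0 := polar_height_gt0.
have -> : polar_side = 2 * polar_side - polar_side by ring.
rewrite -[polar_height]subr0.
apply: vol_vertical_box_ge; [lra|exact: ltW|].
move=> x xd; rewrite -heightE => /andP[h0 hp].
have i0 : (0 : 'I_n) != ord_max by [].
have cs : c ^+ 2 + s ^+ 2 = 1 := cs1 theta.
have c2 : c ^+ 2 <= 1 by rewrite -cs lerDl sqr_ge0.
have c1 : c <= 1 by rewrite -(@ler_pXn2r _ 2%N) ?nnegrE ?(ltW c0)// expr1n.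
have h2 : height x ^+ 2 <= polar_height ^+ 2 by rewrite ler_pXn2r ?nnegrE ?(ltW p0).
have xi2 : polar_side ^+ 2 <= x 0 0 ^+ 2.
  have /andP[x1 _] := xd 0 i0.
  by rewrite ler_pXn2r ?nnegrE ?(ltW d0)// (le_trans (ltW d0) x1).
have lowA : polar_side ^+ 2 <= dot x x.
  rewrite dot_split (bigD1 0)//= (le_trans xi2)// -addrA lerDl.
  by rewrite addr_ge0 ?sqr_ge0// sumr_ge0// => i _; exact: sqr_ge0.
have d2 : 0 < polar_side ^+ 2 by rewrite exprn_gt0.
apply: mem_polar_body => //.
- exact: lt_le_trans lowA.
- rewrite dot_split.
  have sumle : \sum_(i < n | i != ord_max) x 0 i ^+ 2 <=
      m.+1%:R * (2 * polar_side) ^+ 2.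
    apply: sum_sqr_le => i /xd/andP[x1 x2].
    have xi0 : 0 <= x 0 i by rewrite (le_trans (ltW d0) x1).
    by rewrite ler_pXn2r ?nnegrE//; lra.
  have hle : height x ^+ 2 <= (2 * polar_side) ^+ 2.
    have d20 : 0 <= 2 * polar_side by exact: mulr_ge0 (ler0n _ _) (ltW d0).
    rewrite (le_trans h2)// ler_pXn2r ?nnegrE ?(ltW p0)//.
    have : c * polar_side <= 1 * polar_side by rewrite ler_wpM2r// ltW.
    by rewrite /polar_height; lra.
  apply: le_trans (lerD sumle hle) _.
  have -> : m.+1%:R * (2 * polar_side) ^+ 2 + (2 * polar_side) ^+ 2 = s ^+ 6 / n%:R.
    rewrite -[n%:R]natr1 /polar_side -natr1; field.
    by rewrite natr1 natr1 pnatr_eq0.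
  by rewrite ler_pdivrMr ?ltr0n// ler_peMr ?exprn_ge0 ?(ltW s0)// ler1n.
- apply: le_trans (ler_wpM2l (sqr_ge0 c) lowA).
  have k0 : 0 <= 1 + 2 * c ^+ 2 by rewrite addr_ge0// mulr_ge0// sqr_ge0.
  apply: le_trans (ler_wpM2l k0 h2) _.
  have -> : (1 + 2 * c ^+ 2) * polar_height ^+ 2 =
      (c ^+ 2 * polar_side ^+ 2) * ((1 + 2 * c ^+ 2) / 4).
    by rewrite /polar_height; field.
  by rewrite ler_piMr ?(mulr_ge0 (sqr_ge0 _) (sqr_ge0 _))//; lra.
Qed.

End Volumes.

Theorem mainTheorem3 (R : realType) (n : nat) (theta : R)
  (hn : (2 <= n)%N) (htheta : pi / 2 < theta < pi) (M : R) (hM : 0 < M) :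
  exists S : capillary_hypersurface n theta,
    [/\ capillary_even S, strictly_convex S &
        (M%:E < capillary_volume_product S)%E].
Proof.
case: n hn => [|[|m]]// _.
have /andP[th1 th2] := htheta.
have c0 : 0 < - cos theta.
  rewrite -[theta](subrK pi) cosDpi opprK; apply: cos_gt0_pihalf.
  by have := pi_gt0 R; lra.
have s0 : 0 < sin theta by apply: sin_gt0_pi; have := pi_gt0 R; lra.
pose C := (m.+1%:R)^-1 ^+ m.+1 / 2 *
  (@polar_side R m theta ^+ m.+1 * @polar_height R m theta).
have C0 : 0 < C.
  rewrite /C mulr_gt0 ?divr_gt0 ?exprn_gt0 ?invr_gt0 ?ltr0n//.
  by rewrite mulr_gt0 ?exprn_gt0 ?polar_side_gt0 ?polar_height_gt0.
(* the vertical semi-axis; C is the volume bound divided by b *)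
pose b := (M + 1) / C.
have b0 : 0 < b by rewrite divr_gt0// addr_gt0.
pose D := Num.sqrt (sin theta ^+ 2 + b ^+ 2 * (- cos theta) ^+ 2).
have D20 : 0 < sin theta ^+ 2 + b ^+ 2 * (- cos theta) ^+ 2.
  by apply: addr_gt0; [|apply: mulr_gt0]; exact: exprn_gt0.
have D0 : 0 < D by rewrite sqrtr_gt0.
have D2 : D ^+ 2 = sin theta ^+ 2 + b ^+ 2 * (- cos theta) ^+ 2.
  by rewrite sqr_sqrtr// ltW.
(* the solution of the two equations in z0 and rho, for e = b^-2 *)
pose e := b ^- 2; pose z0 := b ^+ 2 * (- cos theta) / D; pose rho := sin theta / D.
have e0 : 0 < e by rewrite invr_gt0 exprn_gt0.
have z00 : 0 < z0 by apply: divr_gt0 => //; apply: mulr_gt0 => //; exact: exprn_gt0.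
have rho0 : 0 < rho by rewrite divr_gt0.
have bD : (b != 0) && (D != 0) by rewrite !gt_eqF.
have rho1 : rho ^+ 2 + e * z0 ^+ 2 = 1.
  have -> : rho ^+ 2 + e * z0 ^+ 2 =
      (sin theta ^+ 2 + b ^+ 2 * (- cos theta) ^+ 2) / D ^+ 2.
    by rewrite /rho /e /z0; field; rewrite andbC.
  by rewrite -D2 mulfV// gt_eqF// exprn_gt0.
have angle : e * z0 * sin theta = - cos theta * rho.
  by rewrite /rho /e /z0; field; rewrite andbC.
have eb : Num.sqrt e^-1 = b by rewrite invrK sqrtr_sqr gtr0_norm.
exists (capillary_ellipsoid e0 z00 rho0 c0 rho1 angle); split.
- exact: capillary_even_ellipsoid.
- exact: strictly_convex_ellipsoid.
have V1 := vol_solid_ge e0 z00 rho0 c0 rho1 angle (m := m).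
have V2 := vol_polar_ge e0 z00 rho0 c0 s0 rho1 angle (m := m).
have m0 : 0 <= (m.+1%:R)^-1 ^+ m.+1 :> R by rewrite exprn_ge0// invr_ge0.
apply: lt_le_trans (lee_pmul _ _ V1 V2).
- rewrite -EFinM lte_fin eb.
  have -> : (m.+1%:R)^-1 ^+ m.+1 * (b / 2) *
      (@polar_side R m theta ^+ m.+1 * @polar_height R m theta) = b * C by rewrite /C; ring.
  by rewrite /b divfK ?gt_eqF// ltrDl.
- by rewrite lee_fin mulr_ge0// divr_ge0// sqrtr_ge0.
- by rewrite lee_fin mulr_ge0 ?exprn_ge0 ?ltW ?polar_side_gt0 ?polar_height_gt0.
Qed.
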